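(* Consider a Gaussian tensor network embedding $S$ with $N_E$ vertices for which there exists a linearization such that each matricization $A_i$, $i\in\{1,\dots,N_E\}$, has row size $\Omega(N_E\log(1/\delta)/\epsilon^2)$. Then the tensor network embedding $S$ is $(\epsilon,\delta)$-accurate.
   Context: Here $\epsilon$ is the accuracy parameter and $\delta$ the failure probability; $\Omega(\cdot)$ means at least a (sufficiently large) absolute constant times the argument. A tensor network embedding is a matrix $S$ that is the matricization of a tensor described by a graph tensor network $G_E=(V_E,E_E,w)$ with $N_E=|V_E|$ vertices: each vertex is a tensor, each edge is a tensor dimension, and $w(e)$ is the natural logarithm of the size of the dimension $e$. Each contracted edge is adjacent to two vertices and means that the corresponding two tensor dimensions are summed over. A set $\bar E\subseteq E_E$ of edges, each adjacent to one embedding vertex, connects the embedding to the input data (input dimensions), and a set $E_1\subset E_E$ of uncontracted edges, each adjacent to one embedding vertex, gives the output dimensions. The columns of $S$ are indexed by the dimensions in $\bar E$ jointly, the rows of $S$ by the dimensions in $E_1$ jointly. Linearization: each vertex is given a unique index $i\in\{1,\dots,N_E\}$ and denoted $v_i$; the tensor at $v_i$ is $\mathcal A_i$. $A_i$ denotes the matricization of $\mathcal A_i$ in which all uncontracted (output) dimensions and all contracted dimensions shared with tensors $\mathcal A_j$, $j>i$, are combined into the row, and all other dimensions (input dimensions and contracted dimensions shared with $\mathcal A_j$, $j<i$) into the column. The row size is the product of the sizes of the row dimensions. Gaussian: the tensors $\mathcal A_1,\dots,\mathcal A_{N_E}$ are independent, and for the linearization considered each $A_i$, with row size $m_i$, equals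 $\frac{1}{\sqrt{m_i}}M_i$ where all entries of $M_i$ are i.i.d. $N(0,1)$. A random matrix $S\in\mathbb R^{m\times n}$ is $(\epsilon,\delta)$-accurate if for every $x\in\mathbb R^n$ with $\|x\|_2=1$, $\Pr_S\left(\left|\|Sx\|_2^2-1\right|>\epsilon\right)<\delta$.
   Formalization: The accuracy is restricted to 0 < ε ≤ 1 and the failure probability to 0 < δ ≤ δ0 for an arbitrary fixed δ0 < 1, with the constant in Ω depending only on δ0; no absolute constant works for δ near 1 or unbounded ε. *)

(* Defs.v *)
From HB Require Import structures.
From mathcomp Require Import all_boot all_order all_algebra.
From mathcomp Require Import all_classical all_reals all_analysis.

Set Implicit Arguments.
Unset Strict Implicit.
Unset Printing Implicit Defensive.

Import Order.TTheory GRing.Theory Num.Theory.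
Import numFieldNormedType.Exports.

Local Open Scope ring_scope.

(* A multigraph on vertices V with edges E.  The logarithmic weight of an edge
   e is w(e) = ln (dim e); the integer size [dim e] is what is stored.  An edge
   in [inputs] or [outputs] is dangling on the embedding side and has a single
   endpoint; all the others are contracted and join two distinct vertices. *)
Record tn_graph (V E : finType) := TNGraph {
  ends : E -> {set V};
  inputs : {set E};
  outputs : {set E};
  dim : E -> nat;
  dim_gt0 : forall e, (0 < dim e)%N;
  inputs_outputs_disjoint : (inputs :&: outputs)%SET = finset.set0;
  card_ends : forall e,
    #|ends e| = if (e \in inputs) || (e \in outputs) then 1%N else 2%N }.

Section Network.
Variables (V E : finType) (G : tn_graph V E).

Definition incident (v : V) : {set E} := [set e | v \in ends G e]%SET.

(* Joint values of the dimensions in A. *)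
Definition multi_index (A : {set E}) : finType :=
  {dffun forall e : {e : E | e \in A}, 'I_(dim G (val e))}.

Definition size_of (A : {set E}) : nat := (\prod_(e in A) dim G e)%N.

Lemma card_multi_index (A : {set E}) : #|multi_index A| = size_of A.
Proof.
rewrite /multi_index card_dep_ffun foldrE big_image /=.
under eq_bigr do rewrite card_ord.
by rewrite /size_of [in RHS]big_sub.
Qed.

Definition assignment : finType := {dffun forall e : E, 'I_(dim G e)}.

Definition restrict_index (A : {set E}) (f : assignment) : multi_index A :=
  [ffun e : {e : E | e \in A} => f (val e)].

Lemma in_diff (A B : {set E}) (e : E) :
  e \in A -> ~~ (e \in B) -> e \in (A :\: B)%SET.
Proof. by move=> eA eB; rewrite inE eB. Qed.

Definition glue_index (A B : {set E}) (r : multi_index B)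
    (c : multi_index (A :\: B)%SET) : multi_index A :=
  [ffun e : {e : E | e \in A} =>
     match boolP (val e \in B) with
     | AltTrue eB => r (Sub (val e) eB)
     | AltFalse eB => c (Sub (val e) (in_diff (valP e) eB))
     end].

Section Tensors.
Variable R : realType.

Definition tensor (v : V) : Type := multi_index (incident v) -> R.

(* The edge set B becomes the row, the rest of A the column. *)
Definition matricize (A B : {set E}) (T : multi_index A -> R) :
    'M[R]_(#|multi_index B|, #|multi_index (A :\: B)%SET|) :=
  \matrix_(i, j) T (glue_index (enum_val i) (enum_val j)).

(* Summing over all assignments that agree with the given output and input
   values amounts to summing over the values of the contracted edges. *)
Definition network_mx (T : forall v, tensor v) :
    'M[R]_(#|multi_index (outputs G)|, #|multi_index (inputs G)|) :=
  \matrix_(i, j)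
    \sum_(f : assignment | (restrict_index (outputs G) f == enum_val i)
                        && (restrict_index (inputs G) f == enum_val j))
      \prod_(v : V) T v (restrict_index (incident v) f).

End Tensors.

Section Linearization.
Variable lin : V -> 'I_#|V|.

(* An input edge at v has v as only endpoint, so it is never a row edge. *)
Definition row_edges (v : V) : {set E} :=
  [set e in incident v |
    (e \in outputs G) || [exists u, (u \in ends G e) && (lin v < lin u)%N]]%SET.

Definition row_size (v : V) : nat := size_of (row_edges v).

End Linearization.

End Network.

Section Probability.
Local Open Scope classical_set_scope.
Context d (Omega : measurableType d) (R : realType) (P : probability Omega R).

Definition mutually_independent (I : finType)
    (F : I -> set_system Omega) : Prop :=
  forall (J : {set I}) (B : I -> set Omega),
    (forall i, i \in J -> F i (B i)) ->
    P (\bigcap_(i in [set` J]) B i) = (\prod_(i in J) P (B i))%E.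

Definition sigma_rv (X : Omega -> R) : set_system Omega :=
  preimage_set_system setT X measurable.

Definition sigma_family (K : Type) (X : K -> Omega -> R) : set_system Omega :=
  <<s \bigcup_k sigma_rv (X k) >>.

Definition iid_standard_normal m n (M : 'M[{RV P >-> R}]_(m, n)) : Prop :=
  mutually_independent (fun ij : 'I_m * 'I_n => sigma_rv (M ij.1 ij.2)) /\
  forall i j (B : set R), measurable B ->
    distribution P (M i j) B = normal_prob 0 1 B.

Definition gaussian_tensors (V E : finType) (G : tn_graph V E)
    (lin : V -> 'I_#|V|) (T : forall v, Omega -> tensor G R v) : Prop :=
  mutually_independent
    (fun v => sigma_family
      (fun (k : multi_index G (incident G v)) w => T v w k)) /\
  forall v, exists2 M : 'M[{RV P >-> R}]_(
      #|multi_index G (row_edges G lin v)|,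
      #|multi_index G (incident G v :\: row_edges G lin v)%SET|),
    iid_standard_normal M &
    forall w, matricize (row_edges G lin v) (T v w) =
      (Num.sqrt (row_size G lin v)%:R)^-1 *: \matrix_(i, j) M i j w.

Definition l2norm n (x : 'cV[R]_n) : R := Num.sqrt (\sum_i x i 0 ^+ 2).

Definition accurate m n (S : Omega -> 'M[R]_(m, n)) (eps delta : R) : Prop :=
  forall x : 'cV[R]_n, l2norm x = 1 ->
    (P [set w | (eps < `| l2norm (S w *m x) ^+ 2 - 1 |)%R] < delta%:E)%E.

End Probability.

(* Main.v *)
Require Import Defs.
From mathcomp Require Import all_boot all_order all_algebra.
From mathcomp Require Import all_classical all_reals all_analysis.
From mathcomp Require Import measurable_realfun ring lra.
Import Order.TTheory GRing.Theory Num.Theory.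
Import numFieldNormedType.Exports.
Local Open Scope ring_scope.
Set Implicit Arguments.
Unset Strict Implicit.
Unset Printing Implicit Defensive.

(** Contract the network with the data one tensor at a time, in the order of
the linearization.  When the turn of [v] comes, every column edge of [v]
already dangles from the partially contracted vector, so the step cuts this
vector into slices [x r], one for each value of the remaining dangling edges,
and replaces each slice by [A v *m x r].  Hence the squared norm [s] of the
partially contracted vector becomes [s' = \sum_r |A v *m x r|^2], where the
slices depend only on the earlier tensors and are independent of [A v].

Put [m] for the row size of [v].  For one slice, [m * |A v *m x|^2 / |x|^2]
has the chi-square law with [m] degrees of freedom; its Laplace transform is
computed by integrating out one Gaussian entry after the other
([gaussian_entries_mgf], [gaussian_mulmx_mgf]), since the functions
[exp (- t (c + x g)^2)] of a Gaussian [g] integrate to functions of the same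
shape in [c].  The slices share [A v], so the terms of [s'] are dependent; but
[s' / s] is a convex combination of the normalized terms, and Jensen's
inequality for [exp] shows that its Laplace transform is at most that of a
single term ([gaussian_mulmx_mgf_le]).

It remains to compose the steps.  The norm is multiplied by [#|V|] random
factors, so a function [g] is used for which one step gives
[E g(s') <= exp (8 p^2 / m) g(s)], whatever [s] is:
- for the upper tail, [g(s) = s^p], because [z^p <= exp (p (z - 1))] reduces
  the power moment of [z = s' / s] to its Laplace transform;
- for the lower tail, [g(s) = exp (- p s) + exp (- p)].  For [exp (- p s)]
  alone the loss in one step is unbounded when [s] is large, and the constant
  [exp (- p)] absorbs it; at [s = 1] this constant only doubles the value.
[deviation_functional] adds the two, weighted so that it is at least 1 as soon
as the norm is off by more than [eps], and [gaussian_deviation_step] is the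
one-step estimate.  Independence of the tensors turns it into a recursion on
the expectations ([expected_deviation_step], via [independent_fubini]), and
Markov's inequality gives [network_tail_le]: the failure probability is at
most [3 exp (\sum_v 8 p^2 / m_v - p eps / 2)].  With [p] of order
[ln (1 / delta) / eps] and [m_v] at least a large multiple of
[#|V| ln (1 / delta) / eps^2], the sum is at most [ln (1 / delta)], while
[p eps / 2] is at least [2 ln (1 / delta) + 3]. *)

(** * Measurability and independence *)

Section MeasureComplements.
Local Open Scope classical_set_scope.
Context d (S : measurableType d) (R : realType).

Lemma measurable_sum_cond (I : finType) (Q : pred I) (h : I -> S -> R) :
  (forall i, Q i -> measurable_fun setT (h i)) ->
  measurable_fun setT (fun w => \sum_(i | Q i) h i w).
Proof.
move=> mh; under eq_fun do rewrite big_mkcond.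
by apply: measurable_sum => i; have [/mh|] := boolP (Q i).
Qed.

Lemma measurable_prod_cond (I : finType) (Q : pred I) (h : I -> S -> R) :
  (forall i, Q i -> measurable_fun setT (h i)) ->
  measurable_fun setT (fun w => \prod_(i | Q i) h i w).
Proof.
move=> mh; under eq_fun do rewrite big_mkcond.
by apply: measurable_prod => i _; have [/mh|] := boolP (Q i).
Qed.

(** The integral of a nonnegative function is the supremum of the integrals of
the simple functions below it. *)
Lemma ge0_le_integral_nonmeas (mu : {measure set S -> \bar R})
    (f g : S -> \bar R) :
  (forall w, 0 <= f w)%E -> (forall w, f w <= g w)%E ->
  (\int[mu]_w f w <= \int[mu]_w g w)%E.
Proof.
move=> f0 fg; have g0 w : (0 <= g w)%E by exact: le_trans (fg w).
rewrite !ge0_integralTE//; apply: le_ereal_sup => _ [h hf <-].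
by exists h => // w; exact: le_trans (fg w).
Qed.

End MeasureComplements.

Section Independence.
Local Open Scope classical_set_scope.
Local Open Scope ereal_scope.
Context d (Omega : measurableType d) (R : realType) (P : probability Omega R).

(** The finite intersections of events of the [F i], [i \in J], form a
pi-system that generates the left-hand sigma-algebra.  On it the finite
measures [A |-> P (A `&` B)] and [A |-> P A * P B] agree by hypothesis, hence
they agree everywhere. *)
Lemma independent_generated (I : finType) (F : I -> set_system Omega)
    (J : {set I}) (k : I) :
  mutually_independent P F ->
  (forall i, F i `<=` measurable) ->
  (forall i, F i setT) -> (forall i, setI_closed (F i)) ->
  k \notin J ->
  forall A B, <<s \bigcup_(i in [set` J]) F i >> A -> F k B ->
    P (A `&` B) = P A * P B.
Proof.
move=> indF Fm FT FI kJ A B sA FkB.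
pose cyl := [set A | exists2 B : I -> set Omega,
  (forall i, F i (B i)) & A = \bigcap_(i in [set` J]) B i].
have cylm : cyl `<=` measurable.
  move=> _ [C FC ->]; apply: fin_bigcap_measurable; first exact: finite_finset.
  by move=> i _; exact: Fm.
have cylI : setI_closed cyl.
  move=> _ _ [C FC ->] [C' FC' ->]; exists (fun i => C i `&` C' i).
    by move=> i; exact: FI.
  by rewrite bigcapI.
have PFI C : (forall i, F i (C i)) ->
    P (\bigcap_(i in [set` J]) C i `&` B) =
    P (\bigcap_(i in [set` J]) C i) * P B.
  move=> FC; pose D i := if i == k then B else C i.
  have DF i : F i (D i) by rewrite /D; case: eqP => [->|].
  have CD i : i \in J -> C i = D i.
    by move=> iJ; rewrite /D; case: eqP => // ik; rewrite -ik iJ in kJ.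
  have -> : \bigcap_(i in [set` J]) C i = \bigcap_(i in [set` J]) D i.
    by apply: eq_bigcapr => i /= iJ; exact: CD.
  have -> : \bigcap_(i in [set` J]) D i `&` B =
            \bigcap_(i in [set` k |: J]%SET) D i.
    apply/seteqP; split => [w [wJ wB] i /=|w wkJ]; rewrite ?inE.
      by case/orP => [/eqP ->|/wJ//]; rewrite /D eqxx.
    split=> [i /= iJ|]; first by apply: wkJ; rewrite /= !inE iJ orbT.
    by have := wkJ k; rewrite /= !inE eqxx /D eqxx; exact.
  rewrite !indF// big_setU1//= [RHS]muleC.
  by rewrite [in LHS]/D eqxx.
have mB : measurable B by exact: Fm FkB.
have PBfin : (0 <= fine (P B))%R by exact: fine_ge0.
pose m1 : {measure set Omega -> \bar R} := mrestr P mB.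
pose m2 : {measure set Omega -> \bar R} := mscale (NngNum PBfin) P.
have m2E X : m2 X = P X * P B.
  by rewrite /m2 /mscale/= [LHS]muleC -[in RHS](@fineK _ (P B)) ?fin_num_measure.
have sub : <<s \bigcup_(i in [set` J]) F i >> `<=` <<s cyl >>.
  apply: smallest_sub; first exact: smallest_sigma_algebra.
  move=> C [i iJ FiC]; apply: sub_sigma_algebra.
  exists (fun j => if j == i then C else setT).
    by move=> j; case: eqP => [->|].
  apply/seteqP; split=> [w Cw j _|w /(_ i iJ)]; last by rewrite eqxx.
  by case: eqP.
suff : m1 A = m2 A.
  by rewrite m2E.
apply: (g_sigma_algebra_measure_unique cyl cylm (fun=> setT)) => //.
- by move=> _; exists (fun=> setT) => //; rewrite bigcapT.
- by rewrite bigcup_const//; exists 0%N.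
- move=> _ [C FC ->]; by rewrite m2E -PFI.
- by move=> _; rewrite ltey_eq fin_num_measure.
- exact: sub.
Qed.

(** The law of [w |-> (w, w)], seen as a random element of the product of the
two generated sigma-algebras, is the product measure.  Working on [Omega]
itself with smaller sigma-algebras avoids the introduction of a measurable
space for each family of random variables. *)
Lemma independent_fubini (F1 F2 : set_system Omega) (f : Omega -> Omega -> R) :
  F1 `<=` measurable -> F2 `<=` measurable ->
  (forall A B, <<s F1 >> A -> <<s F2 >> B -> P (A `&` B) = P A * P B) ->
  (forall w w', 0 <= f w w')%R ->
  measurable_fun [set: g_sigma_algebraType F1 * g_sigma_algebraType F2]
    (fun z => f z.1 z.2) ->
  \int[P]_w (f w w)%:E = \int[P]_w \int[P]_w' (f w w')%:E.
Proof.
move=> F1m F2m indF f0 mf.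
have sub1 : <<s F1 >> `<=` @measurable _ Omega.
  by apply: smallest_sub => //; exact: sigma_algebra_measurable.
have sub2 : <<s F2 >> `<=` @measurable _ Omega.
  by apply: smallest_sub => //; exact: sigma_algebra_measurable.
pose T1 := g_sigma_algebraType F1; pose T2 := g_sigma_algebraType F2.
pose i1 : Omega -> T1 := id.
pose i2 : Omega -> T2 := id.
have mi1 : measurable_fun setT i1 by move=> _ Y mY; rewrite setTI; exact: sub1.
have mi2 : measurable_fun setT i2 by move=> _ Y mY; rewrite setTI; exact: sub2.
pose X1 := mfun_Sub (mem_set mi1). pose X2 := mfun_Sub (mem_set mi2).
pose P1 := distribution P X1.
pose P2 := distribution P X2.
pose diag w := (X1 w, X2 w).
have mdiag : measurable_fun setT diag by exact: measurable_fun_pair.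
pose D := mfun_Sub (mem_set mdiag).
pose P12 := distribution P D.
have E X : measurable X -> (P1 \x P2) X = P12 X.
  apply: product_measure_unique => A B mA mB.
  exact: indF.
have /measurable_EFinP mEf := mf.
set g := EFin \o _ in mEf.
have g0 z : 0 <= g z by rewrite lee_fin.
have -> : \int[P]_w (f w w)%:E = \int[P12]_z g z.
  by rewrite ge0_integral_distribution.
rewrite -(eq_measure_integral _ (fun A mA _ => E A mA)) fubini_tonelli1//.
rewrite ge0_integral_distribution//.
- apply: eq_integral => w _ /=.
  rewrite /fubini_F ge0_integral_distribution//.
  by apply: (measurableT_comp mEf); exact: pair1_measurable.
- exact: measurable_fun_fubini_tonelli_F.
- by move=> w; exact: integral_ge0.
Qed.

End Independence.

Section GeneratedMeasurability.
Local Open Scope classical_set_scope.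
Context d (Omega : measurableType d) (R : realType).

Lemma measurable_fun_generated (F : set_system Omega) (X : Omega -> R) :
  sigma_rv X `<=` F -> measurable_fun [set: g_sigma_algebraType F] X.
Proof.
move=> XF _ B mB; apply: sub_sigma_algebra; apply: XF.
by exists B.
Qed.

Lemma sigma_rv_measurable (X : Omega -> R) :
  measurable_fun setT X -> sigma_rv X `<=` measurable.
Proof. by move=> mX _ [B mB <-]; exact: mX. Qed.

Lemma sigma_rvT (X : Omega -> R) : sigma_rv X setT.
Proof. by exists setT => //; rewrite setTI. Qed.

Lemma sigma_rvI (X : Omega -> R) : setI_closed (sigma_rv X).
Proof.
move=> _ _ [A mA <-] [B mB <-]; exists (A `&` B); first exact: measurableI.
by rewrite !setTI preimage_setI.
Qed.

Lemma sigma_rv_id (X : Omega -> R) : <<s sigma_rv X >> = sigma_rv X.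
Proof.
apply: sigma_algebra_id; apply: sigma_algebra_preimage.
exact: sigma_algebra_measurable.
Qed.

End GeneratedMeasurability.

(** * Laplace transforms of Gaussian quadratic forms *)

Section GaussianIntegral.
Local Open Scope classical_set_scope.
Context (R : realType).
Local Notation mu := (@lebesgue_measure R).

(** The density of the normal law is its Radon-Nikodym derivative with respect
to Lebesgue measure. *)
Lemma ge0_integral_normal_prob (m s : R) (f : R -> \bar R) :
  s != 0 -> measurable_fun [set: R] f -> (forall x, 0 <= f x)%E ->
  (\int[normal_prob m s]_x f x = \int[mu]_x (f x * (normal_pdf m s x)%:E))%E.
Proof.
move=> s0 mf f0.
rewrite -(Radon_Nikodym_SigmaFinite.change_of_variables
  (normal_prob_dominates m s))//.
apply: ae_eq_integral => //.
- apply: emeasurable_funM => //.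
  exact: measurable_int (Radon_Nikodym_SigmaFinite.f_integrable
    (normal_prob_dominates m s)).
- apply: emeasurable_funM => //; apply/measurable_EFinP.
  exact: measurable_normal_pdf.
- apply: ae_eqe_mul2l.
  apply: integral_ae_eq => //.
  + exact: Radon_Nikodym_SigmaFinite.f_integrable (normal_prob_dominates m s).
  + by apply/measurable_EFinP; exact: measurable_normal_pdf.
  + by move=> E _ mE; rewrite -Radon_Nikodym_SigmaFinite.f_integral//;
      exact: normal_prob_dominates.
Qed.

(** Completing the square: the integrand times the standard density is a
multiple of the normal density with standard deviation
[s = (1 + 2 t x^2)^(-1/2)] and mean [m = - 2 t c x s^2].  The offset [c] lets the
result be integrated again against another Gaussian. *)
Lemma gaussian_square_mgf (t c x : R) : 0 < 1 + 2 * t * x ^+ 2 ->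
  (\int[normal_prob 0 1]_y (expR (- (t * (c + x * y) ^+ 2)))%:E =
   ((Num.sqrt (1 + 2 * t * x ^+ 2))^-1 *
    expR (- (t / (1 + 2 * t * x ^+ 2) * c ^+ 2)))%:E)%E.
Proof.
set D := 1 + _ => D0.
have mF : measurable_fun [set: R] (fun y => expR (- (t * (c + x * y) ^+ 2))).
  apply: measurableT_comp => //; apply: measurableT_comp => //.
  apply: measurable_funM => //; apply: measurable_funX.
  by apply: measurable_funD => //; exact: measurable_funM.
rewrite ge0_integral_normal_prob ?oner_neq0//; last first.
  exact/measurable_EFinP.
pose s := (Num.sqrt D)^-1.
have sD0 : 0 < Num.sqrt D by rewrite sqrtr_gt0.
have s0 : 0 < s by rewrite invr_gt0.
have s2 : s ^+ 2 = D^-1 by rewrite exprVn sqr_sqrtr// ltW.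
pose m := - (2 * t * c * x / D).
rewrite -[RHS]mule1 -(integral_normal_pdf m s) -ge0_integralZl_EFin; last 4 first.
- by [].
- by move=> y _; rewrite lee_fin normal_pdf_ge0.
- by apply/measurable_EFinP; exact: measurable_normal_pdf.
- by rewrite mulr_ge0 ?expR_ge0// ltW.
apply: eq_integral => y _; rewrite -!EFinM; congr EFin.
rewrite !normal_pdfE ?oner_neq0 ?gt_eqF//.
have -> : normal_peak 1 = s * normal_peak s.
  rewrite /normal_peak s2 expr1n mul1r -mulrnAr.
  rewrite sqrtrM ?invr_ge0 ?ltW// sqrtrV ?ltW// invfM invrK mulrA.
  by rewrite mulVf ?gt_eqF// mul1r.
set a := expR _; set b := expR _.
suff ab : a * normal_fun 0 1 y = b * normal_fun m s y.
  rewrite -/s mulrCA ab; ring.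
rewrite /a /b /normal_fun -!expRD; congr expR.
rewrite s2 /m /D; field.
by rewrite gt_eqF.
Qed.

End GaussianIntegral.

Lemma sum_sqr_eq0P (R : realDomainType) (I : finType) (n : nat) (Q : pred I)
    (x : I -> 'I_n -> R) r j :
  \sum_(r | Q r) \sum_j x r j ^+ 2 = 0 -> Q r -> x r j = 0.
Proof.
move=> s0 Qr; apply/eqP; rewrite -sqrf_eq0; apply/eqP.
have x_ge0 r' : 0 <= \sum_j x r' j ^+ 2 by apply: sumr_ge0 => ? _; exact: sqr_ge0.
have xr0 : \sum_j x r j ^+ 2 = 0 by apply: (psumr_eq0P _ s0) => // r' _.
by apply: (psumr_eq0P _ xr0) => // j' _; exact: sqr_ge0.
Qed.

Section GaussianMatrix.
Local Open Scope classical_set_scope.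
Context d (Omega : measurableType d) (R : realType) (P : probability Omega R).
Variables (m n : nat) (M : 'M[{RV P >-> R}]_(m, n)).
Hypothesis iidM : iid_standard_normal M.

Let entry (k : 'I_m * 'I_n) : Omega -> R := M k.1 k.2.

Let mentry k : measurable_fun setT (entry k).
Proof. exact: measurable_funPT. Qed.

Let partial_row (s : seq ('I_m * 'I_n)) (x : 'I_n -> R) i w :=
  \sum_(k <- s | k.1 == i) x k.2 * entry k w.

(** The entries listed in [s] are integrated out one by one.  Each integration
replaces, in the row of the entry, the coefficient [t'] of the square by
[t' / (1 + 2 t' x^2)], so that after all of them it is [t / (1 + 2 t q)], with
[q] the sum of the squares of the [x] met in that row. *)
Lemma gaussian_entries_mgf (s : seq ('I_m * 'I_n)) (t : R) (x : 'I_n -> R)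
    (c : 'I_m -> R) :
  uniq s ->
  (forall i, 0 < 1 + 2 * t * \sum_(k <- s | k.1 == i) x k.2 ^+ 2) ->
  (\int[P]_w (expR (- (t * \sum_i (c i + partial_row s x i w) ^+ 2)))%:E =
   (\prod_i ((Num.sqrt (1 + 2 * t * \sum_(k <- s | k.1 == i) x k.2 ^+ 2))^-1 *
     expR (- (t / (1 + 2 * t * \sum_(k <- s | k.1 == i) x k.2 ^+ 2) *
              c i ^+ 2))))%:E)%E.
Proof.
elim: s c => [|k s IH] c /=.
  move=> _ _; under eq_integral do rewrite /partial_row.
  rewrite (_ : (fun _ => _) = cst (expR (- (t * \sum_i c i ^+ 2)))%:E); last first.
    apply/funext => w /=; congr (expR (- (t * _)))%:E.
    by apply: eq_bigr => i _; rewrite big_nil addr0.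
  rewrite integral_cst//= probability_setT mule1; congr EFin.
  rewrite mulr_sumr -sumrN expR_sum; apply: eq_bigr => i _.
  by rewrite big_nil mulr0 addr0 sqrtr1 !invr1 mul1r mulr1.
case/andP => ks us D0.
pose q i := \sum_(k <- s | k.1 == i) x k.2 ^+ 2.
have qE i : \sum_(j <- k :: s | j.1 == i) x j.2 ^+ 2 =
    (if k.1 == i then x k.2 ^+ 2 else 0) + q i.
  by rewrite big_cons; case: ifP => // _; rewrite add0r.
have q_ge0 i : 0 <= q i by apply: sumr_ge0 => j _; exact: sqr_ge0.
have Dq i : 0 < 1 + 2 * t * q i.
  have := D0 i; rewrite qE; case: ifP => _; last by rewrite add0r.
  have := sqr_ge0 (x k.2); move: (q_ge0 i) (x k.2 ^+ 2) => qi0 y y0 H.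
  have [t0|t0] := leP 0 t; first by rewrite ltr_pwDl// !mulr_ge0.
  apply: (lt_le_trans H); rewrite lerD2l mulrDr.
  by rewrite gerDr mulr_le0_ge0//; lra.
pose c' w i := c i + (if k.1 == i then x k.2 * entry k w else 0).
pose f w w' := expR (- (t * \sum_i (c' w i + partial_row s x i w') ^+ 2)).
transitivity (\int[P]_w (f w w)%:E)%E.
  apply: eq_integral => w _; rewrite /f; congr (expR (- (t * _)))%:E.
  apply: eq_bigr => i _; rewrite /c' /partial_row big_cons; congr (_ ^+ 2).
  by case: ifP => _; rewrite ?addr0// addrA.
have [indM lawM] := iidM.
pose Fs := \bigcup_(j in [set` [set j in s]%SET]) sigma_rv (entry j).
have mk : measurable_fun [set: g_sigma_algebraType (sigma_rv (entry k))]
    (entry k) by exact: measurable_fun_generated.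
have ms j : j \in s -> measurable_fun [set: g_sigma_algebraType Fs] (entry j).
  move=> js; apply: measurable_fun_generated => A sA.
  by exists j => //=; rewrite inE.
(* w carries the entry k, which is integrated last, and w' carries those of s. *)
rewrite (@independent_fubini _ _ _ _ (sigma_rv (entry k)) Fs); last 5 first.
- exact: sigma_rv_measurable.
- by move=> A [j _]; exact: sigma_rv_measurable.
- move=> A B; rewrite sigma_rv_id => sA sB; rewrite setIC muleC.
  apply: (independent_generated (F := fun j => sigma_rv (entry j))
    (J := [set j in s]%SET) (k := k)) => //.
  + by move=> j; exact: sigma_rv_measurable.
  + by move=> j; exact: sigma_rvT.
  + by move=> j; exact: sigma_rvI.
  + by rewrite inE.
- by move=> w w'; exact: expR_ge0.
- apply: measurableT_comp => //; apply: measurableT_comp => //.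
  apply: measurable_funM => //; apply: measurable_sum => i.
  apply: measurable_funX; apply: measurable_funD.
    apply: measurable_funD => //; case: (k.1 == i) => //.
    apply: measurable_funM => //.
    exact: (measurableT_comp mk measurable_fst).
  rewrite /partial_row; under eq_fun do rewrite big_seq_cond big_mkcond.
  apply: measurable_sum => j.
  have [js|//] := boolP (j \in s); case: (j.1 == i) => //=.
  apply: measurable_funM => //.
  exact: (measurableT_comp (ms j js) measurable_snd).
under eq_integral do rewrite IH//.
set K := k.1.
pose A := \prod_(i | i != K) ((Num.sqrt (1 + 2 * t * q i))^-1 *
  expR (- (t / (1 + 2 * t * q i) * c i ^+ 2))).
pose B := (Num.sqrt (1 + 2 * t * q K))^-1.
have A0 : 0 <= A.
  by apply: prodr_ge0 => i _; rewrite mulr_ge0 ?expR_ge0// invr_ge0 sqrtr_ge0.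
have B0 : 0 <= B by rewrite invr_ge0 sqrtr_ge0.
pose t' := t / (1 + 2 * t * q K).
have D'E : 1 + 2 * t' * x k.2 ^+ 2 =
    (1 + 2 * t * (x k.2 ^+ 2 + q K)) / (1 + 2 * t * q K).
  by rewrite /t'; field; rewrite gt_eqF// Dq.
have DK : 0 < 1 + 2 * t * (x k.2 ^+ 2 + q K).
  by have := D0 K; rewrite qE /K eqxx.
transitivity (\int[P]_w ((A * B)%:E *
    (expR (- (t' * (c K + x k.2 * entry k w) ^+ 2)))%:E))%E.
  apply: eq_integral => w _; rewrite -EFinM (bigD1 K)//=; congr EFin; rewrite [LHS]mulrC.
  rewrite /c' eqxx -/(q K) -/t' -[RHS]mulrA; congr (_ * _).
  by apply: eq_bigr => i iK; rewrite eq_sym (negbTE iK) addr0.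
pose h y := (expR (- (t' * (c K + x k.2 * y) ^+ 2)))%:E.
have mh : measurable_fun setT h.
  apply/measurable_EFinP.
  apply: measurableT_comp => //; apply: measurableT_comp => //.
  apply: measurable_funM => //; apply: measurable_funX.
  by apply: measurable_funD => //; exact: measurable_funM.
have h0 y : (0 <= h y)%E by rewrite lee_fin expR_ge0.
rewrite ge0_integralZl_EFin//; last 2 first.
- by apply: (measurableT_comp mh); exact: mentry.
- by rewrite mulr_ge0.
have -> : (\int[P]_w (expR (- (t' * (c K + x k.2 * entry k w) ^+ 2)))%:E =
           \int[normal_prob 0 1]_y h y)%E.
  (* The normal law lives on the Borel structure generated by intervals. *)
  pose X : Omega -> measurableTypeR R := entry k.
  have mX : measurable_fun setT X by move=> _ C mC; exact: mentry.
  transitivity (\int[distribution P (mfun_Sub (mem_set mX))]_y h y)%E.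
    by rewrite ge0_integral_distribution.
  by apply: eq_measure_integral => C mC _; exact: lawM.
rewrite gaussian_square_mgf D'E ?divr_gt0// ?Dq//.
rewrite -EFinM; congr EFin; rewrite [RHS](bigD1 K)//= [RHS]mulrC -[LHS]mulrA.
congr (_ * _).
  apply: eq_bigr => i iK.
  by rewrite big_cons eq_sym (negbTE iK).
rewrite qE eqxx mulrA; congr (_ * expR (- (_ * _))).
  rewrite /B sqrtrM ?(ltW DK)// sqrtrV ?(ltW (Dq _))// invfM invrK mulrCA.
  by rewrite mulVf ?mulr1// gt_eqF// sqrtr_gt0 Dq.
by rewrite /t'; field; rewrite !gt_eqF// Dq.
Qed.

Lemma gaussian_mulmx_mgf (t : R) (x : 'I_n -> R) :
  0 < 1 + 2 * t * \sum_j x j ^+ 2 ->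
  (\int[P]_w (expR (- (t * \sum_i (\sum_j M i j w * x j) ^+ 2)))%:E =
   ((Num.sqrt (1 + 2 * t * \sum_j x j ^+ 2))^-1 ^+ m)%:E)%E.
Proof.
move=> D0.
pose s := index_enum ('I_m * 'I_n)%type.
have sumE i (g : 'I_m -> 'I_n -> R) :
    \sum_(k <- s | k.1 == i) g k.1 k.2 = \sum_j g i j.
  rewrite /s (eq_bigl (fun k => (k.1 == i) && true)); last by move=> k; rewrite andbT.
  rewrite -(pair_big (fun j => j == i) xpredT g)/=.
  by rewrite big_pred1_eq.
have E := @gaussian_entries_mgf s t x (fun=> 0) (index_enum_uniq _).
transitivity (\int[P]_w (expR (- (t * \sum_i (0 + partial_row s x i w) ^+ 2)))%:E)%E.
  apply: eq_integral => w _; congr (expR (- (t * _)))%:E.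
  apply: eq_bigr => i _; rewrite add0r /partial_row; congr (_ ^+ 2).
  rewrite (sumE i (fun i j => x j * M i j w)).
  by apply: eq_bigr => j _; rewrite mulrC.
rewrite E => [|i]; last by rewrite (sumE i (fun _ j => x j ^+ 2)).
congr EFin; under eq_bigr => i _.
  rewrite (sumE i (fun _ j => x j ^+ 2)) expr0n/= mulr0 oppr0 expR0 mulr1.
  over.
by rewrite prodr_const card_ord.
Qed.

Lemma measurable_gaussian_square (x : 'I_n -> R) :
  measurable_fun setT (fun w => \sum_i (\sum_j M i j w * x j) ^+ 2).
Proof.
apply: measurable_sum => i; apply: measurable_funX.
by apply: measurable_sum => j; exact: measurable_funM.
Qed.

(** If [s] is nonzero, the exponent is the convex combination, with weights [|x r|^2 / s], of the
exponents attached to the rescaled vectors [y r], all of squared norm [s].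
Convexity of [exp] therefore bounds the left-hand side by the Laplace transform
of a single vector of squared norm [s], however dependent the terms are. *)
Lemma gaussian_mulmx_mgf_le (I : finType) (Q : pred I) (t : R)
    (x : I -> 'I_n -> R) (s := \sum_(r | Q r) \sum_j x r j ^+ 2) :
  0 < 1 + 2 * t * s ->
  (\int[P]_w (expR (- (t * \sum_(r | Q r)
                  \sum_i (\sum_j M i j w * x r j) ^+ 2)))%:E <=
   ((Num.sqrt (1 + 2 * t * s))^-1 ^+ m)%:E)%E.
Proof.
move=> D0.
pose l r := (\sum_j x r j ^+ 2) / s.
pose y r j := x r j / Num.sqrt (l r).
have x_ge0 r : 0 <= \sum_j x r j ^+ 2 by apply: sumr_ge0 => j _; exact: sqr_ge0.
have s_ge0 : 0 <= s by apply: sumr_ge0.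
have l_ge0 r : 0 <= l r by exact: divr_ge0.
have [s0|s0] := eqVneq s 0.
  have x0 r j : Q r -> x r j = 0 by exact: sum_sqr_eq0P s0.
  rewrite s0 mulr0 addr0 sqrtr1 invr1 expr1n.
  rewrite (_ : (fun _ => _) = cst 1%:E) ?integral_cst//= ?probability_setT ?mule1//.
  apply/funext => w; rewrite big1 ?mulr0 ?oppr0 ?expR0// => r Qr.
  rewrite big1// => i _; rewrite big1 ?expr0n// => j _.
  by rewrite x0// mulr0.
have l1 : \sum_(r | Q r) l r = 1 by rewrite -mulr_suml divff.
have xy r j : x r j = Num.sqrt (l r) * y r j.
  rewrite /y; have [l0|l0] := eqVneq (l r) 0.
    rewrite l0 sqrtr0 mul0r; apply: (@sum_sqr_eq0P _ _ _ (pred1 r) x) => //=.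
    rewrite big_pred1_eq; apply/eqP; move/eqP: l0.
    by rewrite mulf_eq0 invr_eq0 (negbTE s0) orbF.
  by rewrite mulrCA divff ?mulr1// sqrtr_eq0 -ltNge lt_neqAle eq_sym l0 l_ge0.
pose u r w := t * \sum_i (\sum_j M i j w * y r j) ^+ 2.
have mu_ r : measurable_fun setT (fun w => expR (- u r w)).
  apply: measurableT_comp => //; apply: measurableT_comp => //.
  by apply: measurable_funM => //; exact: measurable_gaussian_square.
have uE w : t * \sum_(r | Q r) \sum_i (\sum_j M i j w * x r j) ^+ 2 =
    \sum_(r | Q r) l r * u r w.
  rewrite mulr_sumr; apply: eq_bigr => r _; rewrite /u mulrCA; congr (_ * _).
  rewrite mulr_sumr; apply: eq_bigr => i _.
  rewrite -[X in X * _](@sqr_sqrtr _ (l r))// -exprMn mulr_sumr; congr (_ ^+ 2).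
  by apply: eq_bigr => j _; rewrite xy; ring.
apply: (@le_trans _ _ (\int[P]_w \sum_(r | Q r) (l r)%:E * (expR (- u r w))%:E)%E).
  apply: ge0_le_integral => //.
  - apply/measurable_EFinP; apply: measurableT_comp => //.
    apply: measurableT_comp => //; apply: measurable_funM => //.
    by apply: measurable_sum_cond => r _; exact: measurable_gaussian_square.
  - under eq_fun do rewrite big_mkcond.
    apply: emeasurable_sum => r; case: (Q r) => //.
    by apply: emeasurable_funM => //; apply/measurable_EFinP.
  - move=> w _; rewrite uE.
    rewrite [leRHS](_ : _ = (\sum_(r | Q r) l r * expR (- u r w))%:E); last first.
      by rewrite -sumEFin; apply: eq_bigr => r _; rewrite EFinM.
    rewrite lee_fin.
    (* Jensen: average the tangent inequality of exp at - v. *)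
    set v := \sum_(r | Q r) _.
    have vE : \sum_(r | Q r) l r * (expR (- v) * (1 + (v - u r w))) = expR (- v).
      transitivity (expR (- v) * (\sum_(r | Q r) l r * (1 + v)
                                  - \sum_(r | Q r) l r * u r w)).
        rewrite -sumrB mulr_sumr; apply: eq_bigr => r _; ring.
      by rewrite -mulr_suml l1 mul1r -/v addrK mulr1.
    rewrite -[leLHS]vE; apply: ler_sum => r _; apply: ler_wpM2l => //.
    rewrite -[X in _ <= expR X](_ : - v + (v - u r w) = _); last by ring.
    by rewrite expRD ler_wpM2l ?expR_ge0// expR_ge1Dx.
rewrite (_ : (fun _ => _) = fun w => (\sum_r
    if Q r then (l r)%:E * (expR (- u r w))%:E else 0)%E); last first.
  by apply/funext => w; rewrite big_mkcond.
rewrite ge0_integral_sum//; last 2 first.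
- move=> r; case: (Q r) => //.
  by apply: emeasurable_funM => //; apply/measurable_EFinP.
- move=> r w _; case: (Q r) => //.
  by rewrite mule_ge0// lee_fin ?expR_ge0.
set K := _ ^+ m.
have -> : (K%:E = \sum_(r | Q r) (l r)%:E * K%:E)%E.
  rewrite -ge0_sume_distrl; last by move=> r _; rewrite lee_fin.
  by rewrite sumEFin l1 mul1e.
rewrite [leRHS]big_mkcond/=; apply: lee_sum => r _; case: ifP => Qr; last first.
  by rewrite integral0.
rewrite ge0_integralZl_EFin//; last exact/measurable_EFinP.
have [l0|l0] := eqVneq (l r) 0; first by rewrite l0 !mul0e.
apply: lee_wpmul2l; first by rewrite lee_fin.
have ys : \sum_j y r j ^+ 2 = s.
  rewrite /y; under eq_bigr do rewrite exprMn exprVn sqr_sqrtr//.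
  rewrite -mulr_suml /l invf_div mulrCA divff ?mulr1//.
  by apply: contraNneq l0 => H; rewrite /l H mul0r.
by rewrite /u gaussian_mulmx_mgf ys.
Qed.

End GaussianMatrix.

(** * One contraction step *)

Section ScalarBounds.
Variable R : realType.

(** From [1 / (1 + u) = 1 - u / (1 + u) <= exp (- u / (1 + u))].  This replaces
the Laplace transform of a chi-square variable by an exponential. *)
Lemma sqrt_inv_exp_le (u : R) (m : nat) : 0 < 1 + u ->
  (Num.sqrt (1 + u))^-1 ^+ m <= expR (- (m%:R / 2 * (u / (1 + u)))).
Proof.
move=> u0.
have -> : - (m%:R / 2 * (u / (1 + u))) = m%:R * (- (u / (1 + u)) / 2) by ring.
rewrite expRM_natl lerXn2r ?nnegrE ?invr_ge0 ?sqrtr_ge0 ?expR_ge0//.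
rewrite -(@ler_pXn2r _ 2) ?nnegrE ?invr_ge0 ?sqrtr_ge0 ?expR_ge0//.
rewrite exprVn sqr_sqrtr ?(ltW u0)// -expRM_natl mulrCA divff ?mulr1//.
rewrite [leLHS](_ : _ = 1 + - (u / (1 + u))); first exact: expR_ge1Dx.
by field; rewrite gt_eqF.
Qed.

(** Here [x = p s], and [y = x / (1 + 2 x / m)] is the exponent left by one
step.  For [x <= 2 p] the loss [x - y <= 2 x^2 / m] is at most [8 p^2 / m].
For larger [x], [exp (- y)] exceeds [exp (- x)] by at most
[8 p^2 / m] times [exp (- p)]: up to [m / 4] because
[exp (- y) - exp (- x) <= (2 x^2 / m) exp (- y)] and [y >= 2 x / 3], beyond
because [y >= m / 6] while [p <= m / 12]. *)
Lemma lower_functional_step (m p x : R) : 2 <= p -> 12 * p <= m -> 0 <= x ->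
  expR (- (x / (1 + 2 * x / m))) + expR (- p) <=
  expR (8 * p ^+ 2 / m) * (expR (- x) + expR (- p)).
Proof.
move=> p2 pm x0.
have m0 : 0 < m by lra.
set a := 8 * p ^+ 2 / m.
have sqr8 (c z : R) : 0 <= c -> 0 <= c * z ^+ 2 / m.
  by move=> c0; apply: divr_ge0 (ltW m0); apply: mulr_ge0 => //; exact: sqr_ge0.
have a0 : 0 <= a by exact: sqr8.
have Ka : 1 + a <= expR a by exact: expR_ge1Dx.
set y := x / (1 + 2 * x / m).
have xm0 : 0 <= x / m by exact: divr_ge0 (ltW m0).
have xmE : 2 * x / m = 2 * (x / m) by rewrite mulrA.
have D0 : 0 < 1 + 2 * x / m by rewrite xmE; lra.
have yE : y * (1 + 2 * x / m) = x by rewrite /y divfK// gt_eqF.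
have yqE : y + 2 * y * (x / m) = x by rewrite -[RHS]yE; ring.
have y0 : 0 <= y by exact: divr_ge0 (ltW D0).
have yx : y <= x by rewrite -[leRHS]yE ler_peMr// xmE; lra.
have yge : x - 2 * x ^+ 2 / m <= y.
  have : 2 * y * (x / m) <= 2 * x * (x / m) by rewrite ler_wpM2r//; lra.
  have -> : 2 * x ^+ 2 / m = 2 * x * (x / m) by ring.
  by lra.
have [x2p|x2p] := leP x (2 * p).
  have ya : x - a <= y.
    apply: le_trans yge; rewrite lerD2l lerN2 /a ler_pM2r ?invr_gt0//.
    have : x ^+ 2 <= (2 * p) ^+ 2 by rewrite lerXn2r ?nnegrE//; lra.
    by rewrite exprMn; lra.
  rewrite mulrDr lerD//.
    by rewrite -expRD ler_expR; lra.
  by rewrite ler_peMl ?expR_ge0//; lra.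
suff H : expR (- y) <= expR (- x) + a * expR (- p).
  have e1 := expR_ge0 (- x); have e2 := expR_ge0 (- p).
  have : (1 + a) * (expR (- x) + expR (- p)) <=
    expR a * (expR (- x) + expR (- p)) by rewrite ler_wpM2r// addr_ge0.
  apply: le_trans; rewrite mulrDl mul1r mulrDr.
  have : 0 <= a * expR (- x) by rewrite mulr_ge0.
  by lra.
have [xm|xm] := leP x (m / 4).
  have y23 : 2 / 3 * x <= y.
    have : y * (x / m) <= y * (1 / 4).
      by rewrite ler_wpM2l// ler_pdivrMr//; lra.
    by lra.
  set b := 2 * x ^+ 2 / m in yge.
  have b0 : 0 <= b by exact: sqr8.
  have h1 : expR (- y) - b * expR (- y) <= expR (- x).
    apply: (@le_trans _ _ (expR (- y) * expR (- b))); last first.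
      by rewrite -expRD ler_expR; lra.
    have := expR_ge1Dx (- b); have := expR_ge0 (- y) => e1 e2.
    have : expR (- y) * (1 - b) <= expR (- y) * expR (- b) by rewrite ler_wpM2l.
    by rewrite mulrBr mulr1 [_ * b]mulrC.
  suff : b * expR (- y) <= a * expR (- p) by lra.
  rewrite /a /b [X in X <= _]mulrAC [X in _ <= X]mulrAC ler_pM2r ?invr_gt0//.
  (* x^2 exp (- y) is compared with its bound at x = 2 p. *)
  pose z := x - 2 * p.
  have xE : x = 2 * p * (1 + z / (2 * p)) by rewrite /z; field; lra.
  have h2 : (1 + z / (2 * p)) ^+ 2 <= expR (z / p).
    rewrite (_ : z / p = z / (2 * p) *+ 2); last by rewrite mulr2n; field; lra.
    rewrite mulr2n expRD -expr2 lerXn2r ?nnegrE ?expR_ge0 ?expR_ge1Dx//.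
    by rewrite addr_ge0// divr_ge0 /z; lra.
  have h3 : z / p <= y - p.
    have : z / p <= z / 2 by rewrite ler_pM2l ?lef_pV2 ?posrE /z; lra.
    by rewrite /z; lra.
  have -> : 2 * x ^+ 2 * expR (- y) =
     8 * p ^+ 2 * ((1 + z / (2 * p)) ^+ 2 * expR (- y)).
    by rewrite [in LHS]xE; ring.
  apply: ler_wpM2l; first by apply: mulr_ge0 => //; exact: sqr_ge0.
  apply: (@le_trans _ _ (expR (z / p) * expR (- y))).
    by rewrite ler_wpM2r ?expR_ge0.
  by rewrite -expRD ler_expR; lra.
have y6 : m / 6 <= y.
  have : m / 6 * (1 + 2 * x / m) <= y * (1 + 2 * x / m).
    rewrite yE (_ : _ * _ = m / 6 + x / 3); last by field; lra.
    by lra.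
  by rewrite ler_pM2r.
suff : expR (- y) <= a * expR (- p) by have := expR_ge0 (- x); lra.
apply: (@le_trans _ _ (expR (- (m / 12)) * expR (- p))).
  by rewrite -expRD ler_expR; lra.
rewrite ler_wpM2r ?expR_ge0// expRN.
apply: (@le_trans _ _ ((m / 12)^-1)).
  by rewrite lef_pV2 ?posrE ?expR_gt0 ?divr_gt0//; have := expR_ge1Dx (m / 12); lra.
rewrite invf_div /a ler_pM2r ?invr_gt0//.
have : 2 ^+ 2 <= p ^+ 2 by rewrite lerXn2r ?nnegrE//; lra.
by lra.
Qed.

Lemma power_functional_step (m p : R) : 0 <= p -> 12 * p <= m -> 0 < m ->
  p / (1 - 2 * p / m) <= p + 8 * p ^+ 2 / m.
Proof.
move=> p0 pm m0.
have pm6 : 2 * p / m <= 1 / 6 by rewrite ler_pdivrMr//; lra.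
rewrite -mulrA in pm6 *.
rewrite ler_pdivrMr; last by lra.
have -> : 8 * p ^+ 2 / m = 8 * p * (p / m) by ring.
have q0 : 0 <= p / m by exact: divr_ge0 (ltW m0).
move: (p / m) pm6 q0 => q q6 q0.
have pq0 : 0 <= p * q by exact: mulr_ge0.
have : p * q * q <= p * q * (1 / 12) by rewrite ler_wpM2l//; lra.
by nra.
Qed.

End ScalarBounds.

(** The first summand detects [s > 1 + eps], the second [s < 1 - eps]. *)
Definition deviation_functional (R : realType) (p : nat) (eps s : R) : R :=
  (1 + eps)^-1 ^+ p * s ^+ p +
  expR (p%:R * (1 - eps)) * (expR (- (p%:R * s)) + expR (- p%:R)).

Section DeviationStep.
Context d (Omega : measurableType d) (R : realType) (P : probability Omega R).
Variables (m n : nat) (M : 'M[{RV P >-> R}]_(m, n)).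
Hypothesis iidM : iid_standard_normal M.
Variables (I : finType) (Q : pred I) (x : I -> 'I_n -> R) (p : nat).
Hypotheses (p2 : (2 <= p)%N) (pm : (12 * p <= m)%N).

Let s := \sum_(r | Q r) \sum_j x r j ^+ 2.
Let U w := \sum_(r | Q r) \sum_i (\sum_j M i j w * x r j) ^+ 2.
Let K : R := expR (8 * p%:R ^+ 2 / m%:R).

Let mU : measurable_fun setT U.
Proof.
apply: measurable_sum_cond => r _; exact: measurable_gaussian_square.
Qed.

Let s_ge0 : 0 <= s.
Proof. by apply: sumr_ge0 => r _; apply: sumr_ge0 => j _; exact: sqr_ge0. Qed.

Let U_ge0 w : 0 <= U w.
Proof. by apply: sumr_ge0 => r _; apply: sumr_ge0 => j _; exact: sqr_ge0. Qed.

Let pR : 2 <= p%:R :> R. Proof. by rewrite ler_nat. Qed.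

Let pmR : 12 * p%:R <= m%:R :> R. Proof. by rewrite -natrM ler_nat. Qed.

Let m0 : 0 < m%:R :> R. Proof. by move: pR pmR; lra. Qed.

Let mexpU t : measurable_fun setT (fun w => expR (- (t * U w))).
Proof.
apply: measurableT_comp => //; apply: measurableT_comp => //.
exact: measurable_funM.
Qed.

(** With [z = U w / (m s)], the bound [z^p <= exp (p (z - 1))] leads to a Laplace
transform at the negative parameter [t = - p / (s m)], where it is finite since
[p] is small compared to [m]. *)
Lemma gaussian_power_step :
  (\int[P]_w ((U w / m%:R) ^+ p)%:E <= (K * s ^+ p)%:E)%E.
Proof.
have p0 : (0 < p)%N by exact: leq_trans p2.
have [s0|s0] := eqVneq s 0.
  rewrite s0 expr0n gtn_eqF// mulr0.
  rewrite (_ : (fun _ => _) = cst 0%E) ?integral0//.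
  apply/funext => w; rewrite /U big1 ?mul0r ?expr0n ?gtn_eqF// => r Qr.
  rewrite big1// => i _; rewrite big1 ?expr0n// => j _.
  by rewrite (sum_sqr_eq0P _ s0 Qr) mulr0.
have sgt0 : 0 < s by rewrite lt_neqAle eq_sym s0 s_ge0.
pose t := - (p%:R / (s * m%:R)).
have tsE : 2 * t * s = - (2 * p%:R / m%:R).
  by rewrite /t; field; rewrite s0 gt_eqF.
have q6 : 2 * p%:R / m%:R <= 1 / 6 :> R by rewrite ler_pdivrMr//; move: pmR; lra.
have D0 : 0 < 1 + 2 * t * s by rewrite tsE; lra.
have C0 : 0 <= s ^+ p * expR (- p%:R) by rewrite mulr_ge0 ?expR_ge0 ?exprn_ge0.
apply: (@le_trans _ _ (\int[P]_w ((s ^+ p * expR (- p%:R))%:E *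
                        (expR (- (t * U w)))%:E))%E).
  apply: ge0_le_integral => //.
  - by move=> w _; rewrite lee_fin exprn_ge0// divr_ge0// ltW.
  - apply/measurable_EFinP; apply: measurable_funX.
    exact: measurable_funM.
  - apply/measurable_EFinP; exact: measurable_funM.
  - move=> w _; rewrite -EFinM lee_fin -mulrA -expRD.
    have -> : - p%:R + - (t * U w) = p%:R * (U w / m%:R / s - 1).
      by rewrite /t; field; rewrite s0 gt_eqF.
    rewrite expRM_natl -exprMn lerXn2r ?nnegrE ?divr_ge0 ?(ltW m0)//.
      by rewrite mulr_ge0 ?expR_ge0.
    have -> : U w / m%:R = s * (U w / m%:R / s) by field; rewrite s0 gt_eqF.
    rewrite ler_wpM2l//; set z := U w / m%:R / s.
    by have := expR_ge1Dx (s * z / s - 1); rewrite [s * z]mulrC mulfK//; lra.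
rewrite ge0_integralZl_EFin//; last exact/measurable_EFinP.
apply: (@le_trans _ _ ((s ^+ p * expR (- p%:R))%:E *
   ((Num.sqrt (1 + 2 * t * s))^-1 ^+ m)%:E)%E).
  by apply: lee_wpmul2l; [rewrite lee_fin|exact: gaussian_mulmx_mgf_le].
rewrite -EFinM lee_fin -[leLHS]mulrA [leRHS]mulrC; apply: ler_wpM2l.
  exact: exprn_ge0.
rewrite mulrC.
apply: (le_trans (ler_wpM2r (expR_ge0 _) (sqrt_inv_exp_le m D0))).
rewrite -expRD /K ler_expR tsE.
have := power_functional_step (ltW (lt_le_trans (ltr0n _ 2) pR)) pmR m0.
set q := 2 * p%:R / m%:R in q6 *.
have -> : - (m%:R / 2 * (- q / (1 + - q))) = p%:R / (1 - q).
  rewrite /q; field; rewrite gt_eqF//= gt_eqF//.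
  by move: pmR m0; lra.
by lra.
Qed.

Lemma gaussian_exp_step :
  (\int[P]_w (expR (- (p%:R * (U w / m%:R))) + expR (- p%:R))%:E <=
   (K * (expR (- (p%:R * s)) + expR (- p%:R)))%:E)%E.
Proof.
pose t : R := p%:R / m%:R.
have t0 : 0 <= t by rewrite divr_ge0// ltW.
have D0 : 0 < 1 + 2 * t * s by rewrite ltr_pwDl// !mulr_ge0.
rewrite (_ : (fun _ => _) = fun w => ((expR (- (t * U w)))%:E + (expR (- p%:R))%:E)%E); last first.
  apply/funext => w; rewrite -EFinD; congr (expR (- _) + _)%:E.
  by rewrite /t mulrAC -mulrA.
rewrite ge0_integralD//; last exact/measurable_EFinP.
rewrite integral_cst//= probability_setT mule1.
have x0 : 0 <= p%:R * s by rewrite mulr_ge0.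
apply: le_trans (_ : (_ <= (expR (- (p%:R * s / (1 + 2 * (p%:R * s) / m%:R))) + expR (- p%:R))%:E)%E) _; last first.
  by rewrite lee_fin; exact: lower_functional_step.
rewrite EFinD leeD2r//.
apply: (le_trans (gaussian_mulmx_mgf_le iidM D0)); rewrite lee_fin.
apply: (le_trans (sqrt_inv_exp_le m D0)).
rewrite le_eqVlt; apply/orP; left; apply/eqP; congr (expR (- _)).
rewrite /t; field; rewrite gt_eqF//= gt_eqF// .
by move: m0 x0; lra.
Qed.

Lemma gaussian_deviation_step (eps : R) : 0 <= eps ->
  (\int[P]_w (deviation_functional p eps (U w / m%:R))%:E <=
   (K * deviation_functional p eps s)%:E)%E.
Proof.
move=> eps0; rewrite /deviation_functional.
set a := (1 + eps)^-1 ^+ p; set b := expR _.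
have a0 : 0 <= a by rewrite exprn_ge0// invr_ge0 addr_ge0.
have b0 : 0 <= b by exact: expR_ge0.
have mUm : measurable_fun setT (fun w => U w / m%:R) by exact: measurable_funM.
have mUp : measurable_fun setT (fun w => (U w / m%:R) ^+ p).
  exact: measurable_funX.
have mUe : measurable_fun setT
    (fun w => expR (- (p%:R * (U w / m%:R))) + expR (- p%:R)).
  apply: measurable_funD => //; apply: measurableT_comp => //.
  by apply: measurableT_comp => //; exact: measurable_funM.
rewrite (_ : (fun _ => _) = fun w => (a%:E * ((U w / m%:R) ^+ p)%:E +
  b%:E * (expR (- (p%:R * (U w / m%:R))) + expR (- p%:R))%:E)%E); last first.
  by apply/funext => w; rewrite EFinD !EFinM.
have U0 w : 0 <= (U w / m%:R) ^+ p by rewrite exprn_ge0// divr_ge0// ltW.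
have e0 w : 0 <= expR (- (p%:R * (U w / m%:R))) + expR (- p%:R).
  by rewrite addr_ge0 ?expR_ge0.
rewrite ge0_integralD//; last 4 first.
- by move=> w _; rewrite -EFinM lee_fin mulr_ge0.
- by apply: emeasurable_funM => //; exact/measurable_EFinP.
- by move=> w _; rewrite -EFinM lee_fin mulr_ge0.
- by apply: emeasurable_funM => //; exact/measurable_EFinP.
rewrite ge0_integralZl_EFin//; last 2 first.
- by move=> w _; rewrite lee_fin.
- exact/measurable_EFinP.
rewrite ge0_integralZl_EFin//; last exact/measurable_EFinP.
have aE : (0 <= a%:E)%E by rewrite lee_fin.
have bE : (0 <= b%:E)%E by rewrite lee_fin.
apply: (le_trans (leeD (lee_wpmul2l aE gaussian_power_step)
                       (lee_wpmul2l bE gaussian_exp_step))).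
rewrite -!EFinM -EFinD lee_fin le_eqVlt; apply/orP; left; apply/eqP; ring.
Qed.

End DeviationStep.

(** * Partial contraction of the network *)

Section Contraction.
Variables (V E : finType) (G : tn_graph V E).

(** Sums over the values of a set [A] of edges are written as sums over the full
assignments that differ from a given one only on [A]; this avoids casts between
the index types of different edge sets. *)
Definition same_off (A : {set E}) (f g : assignment G) :=
  [forall e, (e \notin A) ==> (f e == g e)].

Definition fill (A : {set E}) (f : assignment G) (i : multi_index G A) :
    assignment G :=
  [ffun e : E => match boolP (e \in A) with
                 | AltTrue eA => i (Sub e eA)
                 | AltFalse _ => f e
                 end].

Lemma same_offP (A : {set E}) (f g : assignment G) :
  reflect (forall e, e \notin A -> f e = g e) (same_off A f g).
Proof.
apply: (iffP forallP) => [H e eA|H e].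
  by apply/eqP; move: (H e); rewrite eA.
by apply/implyP => /H ->.
Qed.

Lemma fill_in (A : {set E}) (f : assignment G) (i : multi_index G A) e
  (eA : e \in A) : fill f i e = i (Sub e eA).
Proof.
rewrite ffunE; case: {-}_ / boolP => [eA'|]; last by rewrite eA.
by rewrite (bool_irrelevance eA eA').
Qed.

Lemma fill_notin (A : {set E}) (f : assignment G) (i : multi_index G A) e :
  e \notin A -> fill f i e = f e.
Proof. by move=> eA; rewrite ffunE; case: {-}_ / boolP => // H; rewrite H in eA. Qed.

Lemma fill_restrict (A : {set E}) (f g : assignment G) :
  same_off A f g -> fill f (restrict_index A g) = g.
Proof.
move/same_offP => fg; apply/ffunP => e.
have [eA|eA] := boolP (e \in A); first by rewrite fill_in ffunE.
by rewrite fill_notin// fg.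
Qed.

Lemma restrict_fill (A : {set E}) (f : assignment G) (i : multi_index G A) :
  restrict_index A (fill f i) = i.
Proof.
apply/ffunP => -[e eA]; rewrite ffunE/= (fill_in _ _ eA).
by [].
Qed.

Lemma same_off_fill (A : {set E}) (f : assignment G) (i : multi_index G A) :
  same_off A f (fill f i).
Proof. by apply/same_offP => e eA; rewrite fill_notin. Qed.

Lemma glue_restrict (A B : {set E}) (f : assignment G) :
  glue_index (restrict_index B f) (restrict_index (A :\: B) f) =
  restrict_index A f.
Proof.
by apply/ffunP => -[e eA]; rewrite !ffunE /=; case: {-}_ / boolP => ?; rewrite ffunE.
Qed.

Lemma restrict_eqP (A : {set E}) (f g : assignment G) :
  reflect (forall e, e \in A -> f e = g e)
          (restrict_index A f == restrict_index A g).
Proof.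
apply: (iffP eqP) => [/ffunP H e eA|H].
  by move: (H (Sub e eA)); rewrite !ffunE.
by apply/ffunP => e; rewrite !ffunE H ?(valP e).
Qed.

Section Sums.
Variable R : nmodType.

Lemma sum_same_off (A : {set E}) (f : assignment G) (F : assignment G -> R) :
  \sum_(g | same_off A f g) F g = \sum_i F (fill f (i : multi_index G A)).
Proof.
rewrite (reindex_onto (@fill A f) (@restrict_index _ _ G A)); last first.
  by move=> g; exact: fill_restrict.
by apply: eq_bigl => i; rewrite same_off_fill restrict_fill eqxx.
Qed.

(** Resetting the values on [B] to those of [f] projects the assignments on the
left onto the assignments [r]. *)
Lemma sum_same_offU (A B : {set E}) (f : assignment G) (F : assignment G -> R) :
  [disjoint A & B] ->
  \sum_(g | same_off (A :|: B) f g) F g =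
  \sum_(r | same_off A f r) \sum_(g | same_off B r g) F g.
Proof.
move=> dAB.
pose keep (g : assignment G) : assignment G :=
  [ffun e : E => if e \in B then f e else g e].
rewrite (partition_big keep (same_off A f)) => [|g /same_offP fg]; last first.
  apply/same_offP => e eA; rewrite ffunE; case: ifPn => // eB.
  by rewrite fg// inE negb_or eA.
apply: eq_bigr => r /same_offP fr; apply: eq_bigl => g.
apply/andP/same_offP => [[/same_offP fg /eqP <-] e eB|rg].
  by rewrite ffunE (negbTE eB).
split.
  apply/same_offP => e; rewrite inE negb_or => /andP[eA eB].
  by rewrite -rg// fr.
apply/eqP/ffunP => e; rewrite ffunE; case: ifPn => eB; last by rewrite rg.
by rewrite fr//; apply: contraTN eB => eA; rewrite (disjointFr dAB).
Qed.

End Sums.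

Variable lin : V -> 'I_#|V|.
Hypothesis lin_inj : injective lin.

Definition col_edges (v : V) : {set E} := incident G v :\: row_edges G lin v.

(** After the tensors of index less than [k] are contracted with the data, the
edges [touched k] have appeared, [summed k] have been summed over, and
[dangling k] index the current vector. *)
Definition touched (k : nat) : {set E} :=
  [set e | (e \in inputs G) || [exists u, (u \in ends G e) && (lin u < k)%N]].

Definition summed (k : nat) : {set E} :=
  [set e | [exists u, (e \in col_edges u) && (lin u < k)%N]].

Definition dangling (k : nat) : {set E} := touched k :\: summed k.

(** A column edge of [v] is a non-output edge for which [v] is the last endpoint,
hence each non-output edge is a column edge of exactly one vertex. *)
Lemma col_edgesP (v : V) (e : E) :
  reflect [/\ v \in ends G e, e \notin outputs G &
            forall u, u \in ends G e -> (lin u <= lin v)%N]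
          (e \in col_edges v).
Proof.
rewrite !inE; case: (boolP (v \in ends G e)) => /= ve; last first.
  by constructor => -[].
rewrite andbT negb_or; apply: (iffP andP) => [[eO nex]|[_ eO H]]; split => //.
  move=> u ue; rewrite leqNgt; apply: contra nex => vu.
  by apply/existsP; exists u; rewrite ue.
by apply/existsP => -[u /andP[/H]]; rewrite leqNgt => /negbTE ->.
Qed.

Lemma col_edges_of_top (e : E) : e \notin outputs G ->
  exists v, e \in col_edges v.
Proof.
move=> eO.
have /card_gt0P[v0 v0e] : (0 < #|ends G e|)%N by rewrite card_ends; case: ifP.
have [v ve vmax] := arg_maxnP (fun v => lin v : nat) v0e.
by exists v; apply/col_edgesP.
Qed.

Lemma col_edges_inj (u v : V) (e : E) :
  e \in col_edges u -> v \in ends G e -> ~~ (lin u < lin v)%N.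
Proof. by move=> /col_edgesP[_ _ H] /H; rewrite -leqNgt. Qed.

Lemma incident_summed (v : V) (k : nat) : (k <= lin v)%N ->
  [disjoint incident G v & summed k].
Proof.
move=> kv; apply/pred0P => e /=; rewrite !inE; apply/negbTE/negP => /andP[ve].
move=> /existsP[u /andP[eu uk]].
by have /negP := col_edges_inj eu ve; apply; exact: leq_trans kv.
Qed.

(** A row edge of [v] is an output or leads to a later vertex; having at most two
endpoints, it cannot also be an input or lead to an earlier vertex. *)
Lemma row_touched (v : V) (k : nat) : (k <= lin v)%N ->
  [disjoint row_edges G lin v & touched k].
Proof.
move=> kv; apply/pred0P => e /=; rewrite !inE; apply/negbTE/negP.
case/andP => /andP[ve evO].
have ends_card := card_ends G e.
have io : ~~ ((e \in inputs G) && (e \in outputs G)).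
  have /finset.setP/(_ e) := inputs_outputs_disjoint G.
  by rewrite !inE => ->.
have one u : (e \in inputs G) || (e \in outputs G) -> u \in ends G e -> u = v.
  move=> h ue; move: ends_card; rewrite h => /eqP/cards1P[w Ew].
  by move: ue ve; rewrite Ew !inE => /eqP -> /eqP ->.
have three u u' : u \in ends G e -> u' \in ends G e ->
    (lin u < lin v)%N -> (lin v < lin u')%N -> False.
  move=> ue u'e uv vu'.
  have : (#|[set u; v; u']| <= #|ends G e|)%N.
    by apply: subset_leq_card; apply/fintype.subsetP => w;
       rewrite !inE => /orP[/orP[]|] /eqP ->.
  rewrite ends_card.
  have -> : #|[set u; v; u']| = 3.
    have uv' : u == v = false by apply: contraTF uv => /eqP ->; rewrite ltnn.
    have u'v : u' == v = false by apply: contraTF vu' => /eqP ->; rewrite ltnn.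
    have u'u : u' == u = false.
      by apply: contraTF (ltn_trans uv vu') => /eqP ->; rewrite ltnn.
    by rewrite finset.setUC cardsU1 cards2 !inE uv' u'v u'u.
  by case: ifP.
case/orP => [eI|/existsP[u /andP[ue uk]]].
  case/orP: evO => [eO|/existsP[u /andP[ue vu]]]; first by rewrite eI eO in io.
  by rewrite (one u) ?eI// ltnn in vu.
have uv : (lin u < lin v)%N by exact: leq_trans kv.
case/orP: evO => [eO|/existsP[u' /andP[u'e vu']]].
  by rewrite (one u) ?eO ?orbT// ltnn in uv.
exact: three uv vu'.
Qed.

Lemma summed_touched (k : nat) : summed k \subset touched k.
Proof.
apply/fintype.subsetP => e; rewrite !inE => /existsP[u /andP[/col_edgesP[ue _ _] uk]].
by apply/orP; right; apply/existsP; exists u; rewrite ue.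
Qed.

(** A column edge of [v] that is not an input has a second endpoint, which comes
before [v] by injectivity of [lin]. *)
Lemma col_dangling (v : V) : col_edges v \subset dangling (lin v).
Proof.
apply/fintype.subsetP => e ev; rewrite inE.
have [ve eO H] := col_edgesP v e ev.
have -> /= : e \notin summed (lin v).
  by have /disjointFr -> // := incident_summed (leqnn (lin v)); rewrite inE.
rewrite inE; have [//|eI /=] := boolP (e \in inputs G).
have /cards2P[a [b [ab Eab]]] : #|ends G e| == 2.
  by rewrite card_ends (negbTE eI) (negbTE eO).
have [u ue uv] : exists2 u, u \in ends G e & u != v.
  have [av|av] := eqVneq a v.
    by exists b; rewrite ?Eab ?inE ?eqxx ?orbT// -av eq_sym.
  by exists a; rewrite ?Eab ?inE ?eqxx.
apply/existsP; exists u; rewrite ue ltn_neqAle H// andbT.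
by apply: contra uv => /eqP/val_inj/lin_inj ->.
Qed.

Lemma summedS (v : V) : summed (lin v).+1 = summed (lin v) :|: col_edges v.
Proof.
apply/finset.setP => e; rewrite finset.in_setU !inE.
apply/existsP/orP => [[u /andP[eu]]|[/existsP[u /andP[eu uk]]|ev]].
- rewrite ltnS leq_eqVlt => /orP[/eqP/val_inj/lin_inj uv|uk].
    by right; rewrite -uv; move: eu; rewrite !inE.
  by left; apply/existsP; exists u; rewrite eu.
- by exists u; rewrite eu ltnS ltnW.
- by exists v; rewrite ltnSn andbT !inE.
Qed.

Lemma danglingS (v : V) :
  dangling (lin v).+1 =
  (dangling (lin v) :\: col_edges v) :|: row_edges G lin v.
Proof.
have dr := row_touched (leqnn (lin v)).
have st := fintype.subsetP (summed_touched (lin v)).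
have cd := fintype.subsetP (col_dangling v).
have tS : touched (lin v).+1 = touched (lin v) :|: incident G v.
  apply/finset.setP => e; rewrite finset.in_setU !inE -orbA; congr (_ || _).
  apply/existsP/orP => [[u /andP[ue]]|[/existsP[u /andP[ue uk]]|ve]].
  - rewrite ltnS leq_eqVlt => /orP[/eqP/val_inj/lin_inj <-|uk]; first by right.
    by left; apply/existsP; exists u; rewrite ue.
  - by exists u; rewrite ue ltnS ltnW.
  - by exists v; rewrite ve ltnSn.
apply/finset.setP => e; rewrite /dangling summedS tS.
rewrite !finset.in_setD !finset.in_setU finset.in_setD.
have [er|er] := boolP (e \in row_edges G lin v).
  have et := disjointFr dr er.
  have es : (e \in summed (lin v)) = false.
    by apply/negbTE; apply: contraFN et; exact: st.
  have ec : (e \in col_edges v) = false by rewrite finset.in_setD er.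
  have ei : e \in incident G v by move: er; rewrite finset.in_set => /andP[].
  by rewrite es ec ei !orbT.
have -> : (e \in incident G v) = (e \in col_edges v) by rewrite finset.in_setD er.
rewrite [e \in _ :\: _]finset.in_setD.
by case: (e \in col_edges v); rewrite ?orbT ?orbF.
Qed.

Lemma sum_enum_val (R : nmodType) (S : finType) (F : S -> R) :
  \sum_i F i = \sum_(j < #|S|) F (enum_val j).
Proof. by rewrite -big_enum_val; apply: eq_bigl => i. Qed.

Section Values.
Variables (R : realType) (T : forall v, tensor G R v).
Arguments T : clear implicits.
Variable x : 'cV[R]_#|multi_index G (inputs G)|.

Definition input_value (f : assignment G) : R :=
  x (enum_rank (restrict_index (inputs G) f)) 0.

(** Entry of the partially contracted vector at the values that [f] gives to the
dangling edges. *)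
Definition partial_value (k : nat) (f : assignment G) : R :=
  \sum_(g | same_off (summed k) f g)
    input_value g *
    \prod_(v | (lin v < k)%N) T v (restrict_index (incident G v) g).

(** A base point: the edges outside the dangling ones are pinned to it, so that
each entry of the current vector is counted once in the norm. *)
Definition zero_assignment : assignment G :=
  [ffun e => Ordinal (dim_gt0 G e)].

Definition partial_norm (k : nat) : R :=
  \sum_(f | same_off (dangling k) zero_assignment f) partial_value k f ^+ 2.

(** The slice of the current vector at the values [r] of the dangling edges that
are not column edges of [v]; it is the vector multiplied by [A v]. *)
Definition step_vector (v : V) (r : assignment G)
    (j : 'I_#|multi_index G (col_edges v)|) : R :=
  partial_value (lin v) (fill r (enum_val j)).
Arguments step_vector v r j : clear implicits.

Lemma eq_input_value (f g : assignment G) :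
  (forall e, e \in inputs G -> f e = g e) -> input_value f = input_value g.
Proof. by move=> /restrict_eqP/eqP fg; rewrite /input_value fg. Qed.

Lemma partial_value_touched (k : nat) (f f' : assignment G) :
  (forall e, e \in touched k -> f e = f' e) ->
  partial_value k f = partial_value k f'.
Proof.
move=> ff'; rewrite /partial_value !sum_same_off; apply: eq_bigr => c _.
have E' e : e \in touched k -> fill f c e = fill f' c e.
  move=> et; have [es|es] := boolP (e \in summed k); first by rewrite !fill_in.
  by rewrite !fill_notin// ff'.
congr (_ * _).
  by apply: eq_input_value => e eI; apply: E'; rewrite inE eI.
apply: eq_bigr => v vk; congr (T v _); apply/eqP/restrict_eqP => e.
rewrite inE => ve; apply: E'; rewrite inE; apply/orP; right.
by apply/existsP; exists v; rewrite ve.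
Qed.

Lemma partial_valueS (v : V) (f : assignment G) :
  partial_value (lin v).+1 f =
  \sum_(g | same_off (col_edges v) f g)
     T v (restrict_index (incident G v) g) * partial_value (lin v) g.
Proof.
have dis := incident_summed (leqnn (lin v)).
have dcs : [disjoint col_edges v & summed (lin v)].
  exact: disjointWl (subsetDl _ _) dis.
rewrite /partial_value summedS finset.setUC sum_same_offU//.
apply: eq_bigr => g fg; rewrite mulr_sumr; apply: eq_bigr => h /same_offP gh.
rewrite (bigD1 v)//= mulrCA; congr (_ * (_ * _)).
  congr (T v _); apply/eqP/restrict_eqP => e ve.
  by rewrite gh// (disjointFr dis).
apply: eq_bigl => u; rewrite ltnS ltn_neqAle andbC; congr (_ && _).
by rewrite (inj_eq val_inj) (inj_eq lin_inj).
Qed.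

Lemma partial_norm_split (v : V) :
  partial_norm (lin v) =
  \sum_(r | same_off (dangling (lin v) :\: col_edges v) zero_assignment r)
    \sum_j step_vector v r j ^+ 2.
Proof.
have -> : partial_norm (lin v) = \sum_(f |
    same_off (dangling (lin v) :\: col_edges v :|: col_edges v)
      zero_assignment f) partial_value (lin v) f ^+ 2.
  apply: eq_bigl => f; congr (same_off _ _ f).
  apply/finset.setP => e; rewrite finset.in_setU finset.in_setD.
  have [ev|] := boolP (e \in col_edges v); last by rewrite orbF.
  by rewrite (fintype.subsetP (col_dangling v)).
rewrite sum_same_offU; last first.
  apply/pred0P => e /=; rewrite finset.in_setD.
  by case: (e \in col_edges v); rewrite ?andbF.
apply: eq_bigr => r _; rewrite sum_same_off.
by rewrite (sum_enum_val (fun c => partial_value (lin v) (fill r c) ^+ 2)).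
Qed.

(** The new dangling edges are the old ones that are not column edges of [v],
which enumerate the slices, and the row edges of [v], which enumerate the rows of
the matricization. *)
Lemma partial_normS (v : V) :
  partial_norm (lin v).+1 =
  \sum_(r | same_off (dangling (lin v) :\: col_edges v) zero_assignment r)
    \sum_i (\sum_j matricize (row_edges G lin v) (T v) i j *
                   step_vector v r j) ^+ 2.
Proof.
have drt := row_touched (leqnn (lin v)).
rewrite /partial_norm danglingS sum_same_offU; last first.
  rewrite disjoint_sym; apply: disjointWr drt.
  by apply/fintype.subsetP => e; rewrite !finset.in_setD => /and3P[].
apply: eq_bigr => r _; rewrite sum_same_off.
rewrite sum_enum_val; apply: eq_bigr => i _; congr (_ ^+ 2).
rewrite partial_valueS sum_same_off sum_enum_val.
apply: eq_bigr => j _; rewrite mxE; congr (T v _ * _).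
  apply/ffunP => -[e ve]; rewrite [LHS]ffunE [RHS]ffunE /=.
  case: {-}_ / boolP => er; last exact: fill_in.
  by rewrite fill_notin ?finset.in_setD ?er// fill_in.
apply: partial_value_touched => e et.
have [ec|ec] := boolP (e \in col_edges v); first by rewrite !fill_in.
by rewrite !fill_notin// (disjointFl drt).
Qed.

Lemma partial_norm0 : partial_norm 0 = \sum_i x i 0 ^+ 2.
Proof.
have s0 : summed 0 = finset.set0.
  by apply/finset.setP => e; rewrite !inE; apply/existsP => -[u]; rewrite andbF.
have d0 : dangling 0 = inputs G.
  apply/finset.setP => e; rewrite /dangling s0 !inE/=.
  by rewrite orb_idr// => /existsP[u]; rewrite andbF.
rewrite /partial_norm d0 sum_same_off sum_enum_val.
apply: eq_bigr => i _; congr (_ ^+ 2).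
rewrite /partial_value s0 (big_pred1 (fill zero_assignment (enum_val i))); last first.
  move=> g /=; apply/same_offP/eqP => [H|-> //].
  by apply/ffunP => e; rewrite H// inE.
by rewrite big_pred0 ?mulr1 /input_value ?restrict_fill ?enum_valK.
Qed.

(** At the end exactly the edges that are not outputs have been summed over. *)
Lemma partial_norm_last :
  partial_norm #|V| = \sum_i (network_mx T *m x) i 0 ^+ 2.
Proof.
have sL : summed #|V| = ~: outputs G.
  apply/finset.setP => e; rewrite finset.in_setC inE.
  apply/existsP/idP => [[u /andP[/col_edgesP[] //]]|/col_edges_of_top[u eu]].
  by exists u; rewrite eu ltn_ord.
have dL : dangling #|V| = outputs G.
  apply/finset.setP => e; rewrite finset.in_setD sL finset.in_setC negbK.
  have [eO|//] := boolP (e \in outputs G).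
  rewrite inE; apply/orP; right.
  have /card_gt0P[v ve] : (0 < #|ends G e|)%N by rewrite card_ends; case: ifP.
  by apply/existsP; exists v; rewrite ve/=.
rewrite /partial_norm dL sum_same_off sum_enum_val.
apply: eq_bigr => i _; congr (_ ^+ 2); rewrite mxE /partial_value sL.
pose inp (f : assignment G) := enum_rank (restrict_index (inputs G) f).
rewrite (partition_big inp predT)//=; apply: eq_bigr => j _.
rewrite mxE mulr_suml; apply: eq_big => [f|f /andP[_ /eqP <-]].
  congr (_ && _); last by rewrite -(inj_eq enum_val_inj) enum_rankK.
  apply/same_offP/eqP => [H|H e].
    rewrite -(restrict_fill zero_assignment (enum_val i)).
    by apply/eqP/restrict_eqP => e eO; rewrite H// inE eO.
  rewrite inE negbK => eO; rewrite fill_in -H ffunE //.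
rewrite mulrC /input_value; congr (_ * _).
by apply: eq_bigl => v; rewrite ltn_ord.
Qed.

End Values.
End Contraction.
Arguments step_vector {V E G} lin {R} T x v r j.

(** * Composition of the steps *)

Section MeasurableContraction.
Local Open Scope classical_set_scope.
Context d (S : measurableType d) (R : realType).
Variables (V E : finType) (G : tn_graph V E) (lin : V -> 'I_#|V|).
Variables (T : forall v, S -> tensor G R v) (x : 'cV[R]_#|multi_index G (inputs G)|).
Arguments T : clear implicits.

Lemma measurable_partial_value (k : nat) (f : assignment G) :
  (forall v i, (lin v < k)%N -> measurable_fun setT (fun w => T v w i)) ->
  measurable_fun setT (fun w => partial_value lin (fun v => T v w) x k f).
Proof.
move=> mT; apply: measurable_sum_cond => g _.
apply: measurable_funM => //; apply: measurable_prod_cond => v vk.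
exact: mT.
Qed.

End MeasurableContraction.

Lemma measurable_deviation d (S : measurableType d) (R : realType) (p : nat)
    (eps : R) (h : S -> R) :
  measurable_fun setT h ->
  measurable_fun setT (fun w => deviation_functional p eps (h w)).
Proof.
move=> mh; apply: measurable_funD.
  by apply: measurable_funM => //; exact: measurable_funX.
apply: measurable_funM => //; apply: measurable_funD => //.
apply: measurableT_comp => //; apply: measurableT_comp => //.
exact: measurable_funM.
Qed.

Lemma deviation_functional_ge0 (R : realType) (p : nat) (eps s : R) :
  0 <= eps -> 0 <= s -> 0 <= deviation_functional p eps s.
Proof.
move=> eps0 s0; have e1 : 0 <= (1 + eps)^-1 by rewrite invr_ge0 addr_ge0.
apply: addr_ge0; last by rewrite mulr_ge0 ?addr_ge0 ?expR_ge0.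
by apply: mulr_ge0; exact: exprn_ge0.
Qed.

Section GaussianNetwork.
Local Open Scope classical_set_scope.
Context d (Omega : measurableType d) (R : realType) (P : probability Omega R).
Variables (V E : finType) (G : tn_graph V E) (lin : V -> 'I_#|V|).
Hypothesis lin_inj : injective lin.
Variable T : forall v, Omega -> tensor G R v.
Arguments T : clear implicits.
Hypothesis gaussT : gaussian_tensors P lin T.
Variable x : 'cV[R]_#|multi_index G (inputs G)|.

Let F v := sigma_family (fun (k : multi_index G (incident G v)) w => T v w k).

(** Each index [i] splits into a row and a column, so that each entry of [T v] is
a multiple of a Gaussian entry. *)
Let mT v i : measurable_fun setT (fun w => T v w i).
Proof.
have [_ /(_ v)[M _ TM]] := gaussT.
pose f := fill (zero_assignment G) i.
pose a := enum_rank (restrict_index (row_edges G lin v) f).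
pose b := enum_rank (restrict_index (col_edges G lin v) f).
rewrite (_ : (fun w => T v w i) =
    fun w => (Num.sqrt (row_size G lin v)%:R)^-1 * M a b w).
  exact: measurable_funM.
apply/funext => w; have := TM w => /matrixP/(_ a b); rewrite !mxE => <-.
congr (T v w _); rewrite !enum_rankK -[LHS](restrict_fill (zero_assignment G)).
by rewrite glue_restrict.
Qed.

Let F_tensor v i : sigma_rv (fun w => T v w i) `<=` F v.
Proof. by move=> A sA; apply: sub_sigma_algebra; exists i. Qed.

Let F_measurable v : F v `<=` measurable.
Proof.
apply: smallest_sub; first exact: sigma_algebra_measurable.
by move=> A [i _]; exact: sigma_rv_measurable.
Qed.

Let F_sigma v : sigma_algebra setT (F v).
Proof. exact: smallest_sigma_algebra. Qed.

(** The slices are functions of the tensors before [v], independent of [T v]: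
by Fubini they may be frozen while the one-step estimate is applied to [T v]. *)
Lemma expected_deviation_step (v : V) (p : nat) (eps : R) :
  (2 <= p)%N -> (12 * p <= row_size G lin v)%N -> 0 <= eps ->
  (\int[P]_w (deviation_functional p eps
      (partial_norm lin (fun u => T u w) x (lin v).+1))%:E <=
   (expR (8 * p%:R ^+ 2 / (row_size G lin v)%:R))%:E *
   \int[P]_w (deviation_functional p eps
      (partial_norm lin (fun u => T u w) x (lin v)))%:E)%E.
Proof.
move=> p2 pm eps0.
have [indT /(_ v)[M iidM TM]] := gaussT.
pose Q := same_off (dangling G lin (lin v) :\: col_edges G lin v)
  (zero_assignment G).
pose X w r j := step_vector lin (fun u => T u w) x v r j.
pose A w i j := matricize (row_edges G lin v) (T v w) i j.
(* w carries the tensors before v, and w' the tensor at v. *)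
pose f w w' := deviation_functional p eps
  (\sum_(r | Q r) \sum_i (\sum_j A w' i j * X w r j) ^+ 2).
pose F1 := \bigcup_(u in [set` [set u | (lin u < lin v)%N]%SET]) F u.
have f0 w w' : 0 <= f w w'.
  apply: deviation_functional_ge0 => //; apply: sumr_ge0 => r _.
  by apply: sumr_ge0 => i _; exact: sqr_ge0.
rewrite (_ : (fun _ => _) = fun w => (f w w)%:E); last first.
  by apply/funext => w; rewrite partial_normS.
have mA i j : measurable_fun [set: g_sigma_algebraType (F v)]
    (fun w => A w i j).
  rewrite /A /matricize; under eq_fun do rewrite mxE.
  apply: measurable_fun_generated; exact: F_tensor.
have mX r j : measurable_fun [set: g_sigma_algebraType F1] (fun w => X w r j).
  apply: measurable_partial_value => u i uv; apply: measurable_fun_generated.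
  move=> B sB; exists u; first by rewrite /= inE.
  exact: F_tensor sB.
rewrite (@independent_fubini _ _ _ _ F1 (F v)); last 5 first.
- by move=> B [u _]; exact: F_measurable.
- exact: F_measurable.
- move=> B C sB; rewrite (sigma_algebra_id (F_sigma v)) => FC.
  apply: (independent_generated (F := F)
    (J := [set u | (lin u < lin v)%N]%SET) (k := v)) => //.
  + move=> u; exact: (@measurableT _ (g_sigma_algebraType
      (\bigcup_k sigma_rv (fun w => T u w k)))).
  + move=> u; exact: (@measurableI _ (g_sigma_algebraType
      (\bigcup_k sigma_rv (fun w => T u w k)))).
  + by rewrite inE ltnn.
- exact: f0.
- apply: measurable_deviation; apply: measurable_sum_cond => r _.
  apply: measurable_sum => i; apply: measurable_funX.
  apply: measurable_sum => j; apply: measurable_funM.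
    exact: (measurableT_comp (mA i j) measurable_snd).
  exact: (measurableT_comp (mX r j) measurable_fst).
pose K : R := expR (8 * p%:R ^+ 2 / (row_size G lin v)%:R).
pose N w := partial_norm lin (fun u => T u w) x (lin v).
have N0 w : 0 <= N w by apply: sumr_ge0 => r _; exact: sqr_ge0.
have dN0 w : (0 <= (deviation_functional p eps (N w))%:E)%E.
  by rewrite lee_fin; exact: deviation_functional_ge0.
have mN : measurable_fun setT (fun w => (deviation_functional p eps (N w))%:E).
  apply/measurable_EFinP; apply: measurable_deviation.
  apply: measurable_sum_cond => r _; apply: measurable_funX.
  by apply: measurable_partial_value => u i _; exact: mT.
rewrite -(ge0_integralZl_EFin _ measurableT (fun w _ => dN0 w) mN (expR_ge0 _)).
apply: ge0_le_integral_nonmeas => w.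
  by apply: integral_ge0 => w' _; rewrite lee_fin.
rewrite -EFinM /f.
have mE : row_size G lin v = #|multi_index G (row_edges G lin v)|.
  by rewrite card_multi_index.
rewrite /N partial_norm_split// mE; rewrite mE in pm.
have m0 : 0 < #|multi_index G (row_edges G lin v)|%:R :> R.
  by rewrite ltr0n; apply: leq_trans pm; rewrite muln_gt0/=; exact: leq_trans p2.
apply: le_trans (gaussian_deviation_step iidM Q (X w) p2 pm eps0).
rewrite le_eqVlt; apply/orP; left; apply/eqP; apply: eq_integral => w' _.
congr (deviation_functional _ _ _)%:E.
rewrite mulr_suml; apply: eq_bigr => r _.
rewrite mulr_suml; apply: eq_bigr => i _.
rewrite -[_%:R](@sqr_sqrtr R) ?ler0n// -exprVn -exprMn; congr (_ ^+ 2).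
rewrite mulr_suml; apply: eq_bigr => j _.
rewrite /A TM !mxE mE; ring.
Qed.

Lemma expected_deviation (p : nat) (eps K : R) (k : nat) :
  (2 <= p)%N -> 0 <= eps ->
  (forall v, (12 * p <= row_size G lin v)%N) ->
  (forall v, expR (8 * p%:R ^+ 2 / (row_size G lin v)%:R) <= K) ->
  (k <= #|V|)%N ->
  (\int[P]_w (deviation_functional p eps
      (partial_norm lin (fun u => T u w) x k))%:E <=
   (K ^+ k * deviation_functional p eps (\sum_i x i 0 ^+ 2))%:E)%E.
Proof.
move=> p2 eps0 pm HK; elim: k => [|k IH] kV.
  rewrite expr0 mul1r.
  under eq_integral do rewrite partial_norm0.
  by rewrite integral_cst//= probability_setT mule1.
have [v vk] : exists v, nat_of_ord (lin v) = k.
  have [g _ gK] := inj_card_bij lin_inj (eq_leq (card_ord _)).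
  by exists (g (Ordinal kV)); rewrite gK.
have K0 : 0 <= K by exact: le_trans (expR_ge0 _) (HK v).
rewrite -vk; apply: (le_trans (expected_deviation_step p2 (pm v) eps0)).
have -> : K ^+ (lin v).+1 * deviation_functional p eps (\sum_i x i 0 ^+ 2) =
    K * (K ^+ k * deviation_functional p eps (\sum_i x i 0 ^+ 2)).
  by rewrite vk exprS mulrA.
rewrite EFinM; apply: lee_pmul.
- by rewrite lee_fin expR_ge0.
- apply: integral_ge0 => w _; rewrite lee_fin deviation_functional_ge0//.
  by apply: sumr_ge0 => r _; exact: sqr_ge0.
- by rewrite lee_fin.
- by rewrite vk; apply: IH; exact: ltnW.
Qed.

(** Markov's inequality for the functional, which is at least 1 on the event.  At
the unit data vector it equals [(1 + eps)^(-p) + 2 exp (- p eps)], and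
[1 + eps >= exp (eps / 2)] for [eps <= 1]. *)
Lemma network_tail_le (p : nat) (eps K : R) : (2 <= p)%N -> 0 < eps <= 1 ->
  (forall v, (12 * p <= row_size G lin v)%N) ->
  (forall v, expR (8 * p%:R ^+ 2 / (row_size G lin v)%:R) <= K) ->
  l2norm x = 1 ->
  (P [set w | (eps < `| l2norm (network_mx (fun v => T v w) *m x) ^+ 2 - 1 |)%R] <=
   (K ^+ #|V| * (3 * expR (- (p%:R * eps / 2))))%:E)%E.
Proof.
move=> p2 /andP[eps0 eps1] pm HK x1.
have sum1 : \sum_i x i 0 ^+ 2 = 1.
  have := congr1 (fun z => z ^+ 2) x1.
  rewrite /l2norm sqr_sqrtr ?expr1n//.
  by apply: sumr_ge0 => i _; exact: sqr_ge0.
pose N w := partial_norm lin (fun u => T u w) x #|V|.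
have NE w : l2norm (network_mx (fun v => T v w) *m x) ^+ 2 = N w.
  rewrite /N partial_norm_last// /l2norm sqr_sqrtr//.
  by apply: sumr_ge0 => i _; exact: sqr_ge0.
have N0 w : 0 <= N w by apply: sumr_ge0 => r _; exact: sqr_ge0.
have mN : measurable_fun setT N.
  apply: measurable_sum_cond => r _; apply: measurable_funX.
  by apply: measurable_partial_value => u i _; exact: mT.
set A := [set w | _].
have mA : measurable A.
  have -> : A = [set w | eps < `|N w - 1|].
    by apply/seteqP; split => w; rewrite /A/= NE.
  rewrite -[X in measurable X]setTI.
  have mD : measurable_fun setT (fun w => `|N w - 1|).
    apply: measurableT_comp => //; exact: measurable_funB.
  have := mD measurableT `]eps, +oo[%classic (measurable_itv _).
  by congr measurable; apply/seteqP; split => w /=; rewrite in_itv/= andbT.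
have V1 := expected_deviation p2 (ltW eps0) pm HK (leqnn #|V|).
have K0 : 0 <= K ^+ #|V|.
  case: (pickP (fun _ : V => true)) => [v _|V0].
    by rewrite exprn_ge0// (le_trans (expR_ge0 _) (HK v)).
  by rewrite (eq_card0 V0) expr0.
have pe : 0 <= p%:R * eps by apply: mulr_ge0 => //; exact: ltW.
apply: (@le_trans _ _ (\int[P]_w (deviation_functional p eps (N w))%:E)%E); last first.
  apply: (le_trans V1); rewrite lee_fin sum1 ler_wpM2l// /deviation_functional.
  rewrite expr1n !mulr1.
  have e2 : expR (p%:R * (1 - eps)) * (expR (- p%:R) + expR (- p%:R)) =
      2 * expR (- (p%:R * eps)).
    by rewrite -mulr2n mulrnAr -expRD [RHS]mulr_natl; congr (expR _ *+ 2); ring.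
  have e3 : expR (- (p%:R * eps)) <= expR (- (p%:R * eps / 2)).
    by rewrite ler_expR; lra.
  have e4 : (1 + eps)^-1 ^+ p <= expR (- (p%:R * eps / 2)).
    rewrite (_ : - _ = p%:R * - (eps / 2)); last by ring.
    rewrite expRM_natl lerXn2r ?nnegrE ?expR_ge0 ?invr_ge0 ?addr_ge0 ?(ltW eps0)//.
    have := expR_ge1Dx (- (eps / 2)); apply: le_trans.
    rewrite -[leLHS]mul1r ler_pdivrMr; last by lra.
    by nra.
  by rewrite e2; lra.
rewrite -(setIT A) -integral_indic//.
apply: ge0_le_integral_nonmeas => w; rewrite lee_fin// indicE.
have [wA|_] := boolP (w \in A); last exact: deviation_functional_ge0 (ltW eps0) _.
rewrite inE /A/= NE in wA.
rewrite /deviation_functional.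
have a0 : 0 <= (1 + eps)^-1 by rewrite invr_ge0; lra.
have [N1|N1] := leP 1 (N w).
  rewrite ger0_norm ?subr_ge0// in wA.
  apply: ler_wpDr; first by rewrite mulr_ge0 ?addr_ge0 ?expR_ge0.
  by rewrite -exprMn exprn_ege1// mulrC ler_pdivlMr; lra.
rewrite ler0_norm ?subr_le0 ?(ltW N1)// in wA.
apply: ler_wpDl; first by apply: mulr_ge0; exact: exprn_ge0.
rewrite mulrDr; apply: ler_wpDr; first by rewrite mulr_ge0 ?expR_ge0.
rewrite -expRD; set z := _ + _.
have z0 : 0 <= z by rewrite /z -mulrN -mulrDr; apply: mulr_ge0 => //; lra.
by have := expR_ge1Dx z; rewrite mulr1n; lra.
Qed.

End GaussianNetwork.

(* The constant hidden in Omega(.) is uniform over eps in (0, 1] and over delta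
   in (0, delta0], for any fixed delta0 < 1: no constant works up to delta = 1,
   where log(1/delta) vanishes. *)
Theorem theorem3p1 (R : realType) (delta0 : R) (delta0_lt1 : delta0 < 1) :
  exists2 C : R, 0 < C &
  forall (eps delta : R), 0 < eps <= 1 -> 0 < delta <= delta0 ->
  forall (V E : finType) (G : tn_graph V E)
    (d : measure_display) (Omega : measurableType d) (P : probability Omega R)
    (T : forall v : V, Omega -> tensor G R v),
  (exists lin : V -> 'I_#|V|,
    [/\ injective lin,
        gaussian_tensors P lin T
      & forall v : V,
          C * (#|V|%:R * ln (1 / delta) / eps ^+ 2) <= (row_size G lin v)%:R]) ->
  accurate P (fun w => network_mx (fun v => T v w)) eps delta.
Proof.
have [d00|d00] := leP delta0 0.
  by exists 1 => // eps delta _ /andP[d0 /le_trans/(_ d00)]; rewrite leNgt d0.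
pose L0 := ln (1 / delta0).
have L00 : 0 < L0 by rewrite ln_gt0// div1r invf_gt1.
(* a L >= 4 L + 6 gives p eps / 2 >= 2 L + 3: one L for the product of the step
   factors, one for delta, and exp (- 3) against the constant 3. *)
pose a := 4 + 6 / L0.
have a4 : 4 <= a by rewrite lerDl divr_ge0// ltW.
(* As p <= 2 a L / eps, each 8 p^2 / m_v is then at most L / #|V|. *)
exists (32 * a ^+ 2) => [|eps delta epsP /andP[d0 dd0] V E G d Omega P T].
  by rewrite mulr_gt0// exprn_gt0//; lra.
case=> lin [lin_inj gaussT rows] x x1.
have /andP[eps0 eps1] := epsP.
pose L := ln (1 / delta).
have L0L : L0 <= L.
  by rewrite ler_ln ?posrE ?div1r ?invr_gt0// lef_pV2 ?posrE.
have Lgt0 : 0 < L by exact: lt_le_trans L0L.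
have aL : 4 * L + 6 <= a * L.
  have : 1 <= L / L0 by rewrite ler_pdivlMr// mul1r.
  have -> : a * L = 4 * L + 6 * (L / L0) by rewrite /a; ring.
  by lra.
have deltaE : delta = expR (- L).
  by rewrite /L div1r lnV ?posrE// opprK lnK ?posrE.
pose q := a * L / eps.
have qe : q * eps = a * L by rewrite /q divfK// gt_eqF.
have q6 : 6 <= q by rewrite -(ler_pM2r eps0) qe; nra.
pose p := (Num.truncn q).+1.
have q0 : 0 <= q by lra.
have /andP[pq qp] : (p%:R <= q + 1) && (q < p%:R).
  by have /andP[] := truncn_itv q0; rewrite /p -natr1 lerD2r => -> ->.
have p2 : (2 <= p)%N by rewrite -(ler_nat R); lra.
have p0 : 0 <= p%:R :> R by exact: ler0n.
have size_ge v : 32 * q ^+ 2 * #|V|%:R / L <= (row_size G lin v)%:R.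
  apply: le_trans (rows v); rewrite le_eqVlt; apply/orP; left; apply/eqP.
  by rewrite -/L /q; field; rewrite !gt_eqF.
have size_q v : 32 * q ^+ 2 * #|V|%:R <= (row_size G lin v)%:R * L.
  by rewrite -ler_pdivrMr.
have size_p v : (12 * p <= row_size G lin v)%N.
  have V1 : 1 <= #|V|%:R :> R by rewrite ler1n; apply/card_gt0P; exists v.
  rewrite -(ler_nat R) natrM; apply: le_trans (size_ge v); rewrite ler_pdivlMr//.
  have Lq : L <= q by nra.
  have : 32 * q ^+ 2 * 1 <= 32 * q ^+ 2 * #|V|%:R by rewrite ler_wpM2l// mulr_ge0// sqr_ge0.
  have : 12 * p%:R * L <= 12 * (2 * q) * q by apply: ler_pM => //; lra.
  by rewrite expr2; nra.
have row0 v : 0 < (row_size G lin v)%:R :> R.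
  by rewrite ltr0n (leq_trans _ (size_p v))// muln_gt0.
have HK v : expR (8 * p%:R ^+ 2 / (row_size G lin v)%:R) <= expR (L / #|V|%:R).
  have V1 : 1 <= #|V|%:R :> R by rewrite ler1n; apply/card_gt0P; exists v.
  have Vgt0 : 0 < #|V|%:R :> R by exact: lt_le_trans V1.
  rewrite ler_expR ler_pdivrMr// mulrAC ler_pdivlMr//.
  rewrite [leRHS]mulrC; apply: le_trans (size_q v).
  apply: ler_wpM2r; first exact: ltW.
  have -> : 32 * q ^+ 2 = 8 * (2 * q) ^+ 2 by ring.
  by apply: ler_wpM2l => //; rewrite lerXn2r ?nnegrE//; lra.
apply: (le_lt_trans (network_tail_le lin_inj gaussT p2 epsP size_p HK x1)).
rewrite lte_fin deltaE.
have KV : expR (L / #|V|%:R) ^+ #|V| <= expR L.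
  have [V0|V0] := eqVneq #|V| 0%N; first by rewrite V0 expr0 -[leLHS]expR0 ler_expR ltW.
  by rewrite -expRM_natl mulrCA divff ?mulr1// pnatr_eq0.
have e0 := expR_ge0 (- (p%:R * eps / 2)).
apply: (@le_lt_trans _ _ (expR L * (3 * expR (- (p%:R * eps / 2))))).
  by rewrite ler_wpM2r// mulr_ge0.
have pe : 2 * L + 3 <= p%:R * eps / 2.
  have : q * eps <= p%:R * eps by rewrite ler_wpM2r// ltW.
  by rewrite qe; lra.
rewrite mulrCA -expRD.
have h : expR (L + - (p%:R * eps / 2)) <= expR (- L) * expR (- 3).
  by rewrite -expRD ler_expR; lra.
have eL := expR_gt0 (- L).
have e3 : 3 * expR (- 3) < 1 :> R.
  rewrite expRN ltr_pdivrMr ?expR_gt0// mul1r.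
  by have := expR_ge1Dx (3 : R); lra.
by nra.
Qed.
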